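(* Consider the discrete variational inequality: find $(u_{hp},p_{hp})\in V_{hp}\times Q_{hp}$ such that $$a\big((u_{hp},p_{hp}),(v_{hp}-u_{hp},q_{hp}-p_{hp})\big)+\psi_{hp}(q_{hp})-\psi_{hp}(p_{hp})\ge\ell(v_{hp}-u_{hp})\qquad\forall (v_{hp},q_{hp})\in V_{hp}\times Q_{hp}, \tag{VI$_{hp}$}$$ and the discrete mixed problem: find $(u_{hp},p_{hp},\lambda_{hp})\in V_{hp}\times Q_{hp}\times\Lambda^{(w)}_{hp}$ such that $$a\big((u_{hp},p_{hp}),(v_{hp},q_{hp})\big)+(\lambda_{hp},q_{hp})_{0,\Omega}=\ell(v_{hp})\ \ \forall (v_{hp},q_{hp})\in V_{hp}\times Q_{hp},\qquad(\mu_{hp}-\lambda_{hp},p_{hp})_{0,\Omega}\le0\ \ \forall\mu_{hp}\in\Lambda^{(w)}_{hp}. \tag{M$_{hp}$}$$ If $(u_{hp},p_{hp})\in V_{hp}\times Q_{hp}$ solves (VI$_{hp}$), then $(u_{hp},p_{hp},\lambda_{hp})$ with $$\lambda_{hp}=\mathcal{P}_{hp}\big(\operatorname{dev}(\sigma(u_{hp},p_{hp})-\mathbb{H}p_{hp})\big)$$ is a solution of (M$_{hp}$). Conversely, if $(u_{hp},p_{hp},\lambda_{hp})\in V_{hp}\times Q_{hp}\times\Lambda^{(w)}_{hp}$ solves (M$_{hp}$), then $(u_{hp},p_{hp})$ solves (VI$_{hp}$) and $\lambda_{hp}=\mathcal{P}_{hp}(\operatorname{dev}(\sigma(u_{hp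},p_{hp})-\mathbb{H}p_{hp}))$.
   Context: Let $d\in\{2,3\}$, $\Omega\subset\mathbb{R}^d$ a bounded domain with Lipschitz boundary $\Gamma=\partial\Omega$, $\Gamma_D\subseteq\Gamma$ and $\Gamma_N:=\Gamma\setminus\overline{\Gamma_D}$. $\mathbb{S}_{d,0}$ is the space of symmetric real $d\times d$ matrices with vanishing trace; $:$ is the Frobenius inner product and $|\cdot|_F$ its norm. $(\cdot,\cdot)_{0,\Omega}$ is the $L^2(\Omega)$ inner product for vector- or matrix-valued functions. $V:=\{v\in H^1(\Omega,\mathbb{R}^d): v=0\text{ on }\Gamma_D\}$ (traces), $Q:=L^2(\Omega,\mathbb{S}_{d,0})$. $\varepsilon(v):=\frac12(\nabla v+(\nabla v)^\top)$; $\sigma(v,q):=\mathbb{C}(\varepsilon(v)-q)$. The fourth-order tensors $\mathbb{C}$ and $\mathbb{H}$ have entries in $L^\infty(\Omega)$, satisfy $\mathbb{C}_{ijkl}=\mathbb{C}_{jilk}=\mathbb{C}_{klij}$, $\mathbb{H}_{ijkl}=\mathbb{H}_{jilk}=\mathbb{H}_{klij}$, and are uniformly elliptic: there are $c_e,c_h>0$ with $(\mathbb{C}\tau):\tau\ge c_e|\tau|_F^2$ for all symmetric $\tau$ and $(\mathbb{H}\tau):\tau\ge c_h|\tau|_F^2$ for all $\tau\in\mathbb{S}_{d,0}$, a.e. in $\Omega$. $\sigma_y>0$ is a constant. Data: $f\in V^\star$, $g\in H^{-1/2}(\Gamma_N,\mathbb{R}^d)$ (dual of the space of traces of $V$ restricted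 to $\Gamma_N$). $$a\big((v,q),(w,\tau)\big):=(\sigma(v,q),\varepsilon(w)-\tau)_{0,\Omega}+(\mathbb{H}q,\tau)_{0,\Omega},\qquad \ell(v):=\langle f,v\rangle+\langle g,v\rangle_{\Gamma_N}.$$ For a matrix $\tau$, $\operatorname{dev}\tau:=\tau-\frac1d(\operatorname{tr}\tau)I$. Discretization. $\mathcal{T}_h$ is a locally quasi-uniform finite element mesh of $\Omega$ of convex, shape regular quadrilaterals ($d=2$) or hexahedrons ($d=3$); $\widehat T=[-1,1]^d$; $F_T:\widehat T\to T$ is the bi-/tri-linear bijective element mapping; $h_T$ is the element size and $p_T\in\mathbb{N}$, $p_T\ge1$, the polynomial degree of $T$, with the degrees of neighboring elements comparable. $\mathbb{P}_r(\widehat T)$ is the space of polynomials on $\widehat T$ of degree at most $r$ in each variable. $$V_{hp}:=\{v\in V: v|_T\circ F_T\in(\mathbb{P}_{p_T}(\widehat T))^d\ \forall T\in\mathcal{T}_h\},\quad Q_{hp}:=\{q\in Q: q|_T\circ F_T\in(\mathbb{P}_{p_T-1}(\widehat T))^{d\times d}\ \forall T\in\mathcal{T}_h\}.$$ $\mathcal{P}_{hp}:Q\to Q_{hp}$ is the $L^2$-projection. For $T\in\mathcal{T}_h$ let $\hat x_{k,T}$, $k=1,\dots,n_T:=p_T^d$, be the tensor product Gauss quadrature points on $\widehat T$ ($p_T$ per direction) with positive weights $\hat\omega_{k,T}$. The discrete plasticity functional is $$\psi_{hp}(q_{hp}):=\sum_{T\in\mathcal{T}_h}\mathcal{Q}_{hp,T}(\sigma_y|q_{hp}|_F),\qquad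 \mathcal{Q}_{hp,T}(\varphi):=\begin{cases}|T|\,\varphi(F_T(0)),&p_T=1,\\ \sum_{k=1}^{n_T}\hat\omega_{k,T}\,|\det\nabla F_T(\hat x_{k,T})|\,\varphi(F_T(\hat x_{k,T})),&p_T\ge2.\end{cases}$$ $$\Lambda^{(w)}_{hp}:=\{\mu_{hp}\in Q_{hp}: (\mu_{hp},q_{hp})_{0,\Omega}\le\psi_{hp}(q_{hp})\ \forall q_{hp}\in Q_{hp}\}.$$ *)

(* Defs.v *)
From HB Require Import structures.
From mathcomp Require Import all_boot all_order all_algebra.
From mathcomp Require Import all_classical all_reals all_analysis.

Set Implicit Arguments.
Unset Strict Implicit.
Unset Printing Implicit Defensive.

Import Order.TTheory GRing.Theory Num.Theory.
Import numFieldNormedType.Exports.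

Local Open Scope classical_set_scope.
Local Open Scope ring_scope.

Definition rV_display : measure_display.
Proof. exact. Qed.

Section rV_borel.
Context (R : realType) (d : nat).

Definition rV_coord (i : 'I_d) (x : 'rV[R]_d) : measurableTypeR R := x ord0 i.

(* Generated by the coordinates, which is the Borel sigma-algebra of R^d; same
   construction as the library's sigma-algebra on [d.-tuple R]. *)
Definition rV_measurable : set (set 'rV[R]_d) := g_sigma_preimage rV_coord.

Let rV_measurable0 : rV_measurable set0.
Proof. exact: sigma_algebra0. Qed.

Let rV_measurableC A : rV_measurable A -> rV_measurable (~` A).
Proof. exact: sigma_algebraC. Qed.

Let rV_measurable_bigcup (F : _^nat) :
  (forall i, rV_measurable (F i)) -> rV_measurable (\bigcup_i (F i)).
Proof. exact: sigma_algebra_bigcup. Qed.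

HB.instance Definition _ := @isMeasurable.Build rV_display
  'rV[R]_d rV_measurable rV_measurable0 rV_measurableC rV_measurable_bigcup.

Lemma measurable_rV_coord (i : 'I_d) : measurable_fun setT (rV_coord i).
Proof.
move=> _ A mA; apply: sub_sigma_algebra; rewrite /= -bigcup_seq/=.
exists i => /=; first by rewrite mem_index_enum.
by exists A.
Qed.

End rV_borel.

Section rV_cons.
Context (R : realType) (d : nat).

Definition rV_cons (x : measurableTypeR R * 'rV[R]_d) : 'rV[R]_d.+1 :=
  row_mx (const_mx x.1 : 'rV[R]_1) x.2.

Lemma measurable_rV_cons : measurable_fun setT rV_cons.
Proof.
apply: (@measurability _ _ _ _ _ _ (\big[setU/set0]_(i < d.+1)
  preimage_set_system setT (@rV_coord R d.+1 i) measurable)) => //.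
rewrite -bigcup_mkord_ord => _ [B [i Id [A mA <-] <-]].
rewrite !setTI -comp_preimage.
case: (splitP (inord i : 'I_(1 + d))) => j Ej.
  have -> : @rV_coord R d.+1 (inord i) \o rV_cons = fst.
    apply/funext => x /=; rewrite /rV_coord /rV_cons.
    have -> : (inord i : 'I_(1 + d)) = lshift d j by apply/val_inj.
    by apply: etrans (row_mxEl (const_mx x.1) x.2 ord0 j) _; rewrite mxE.
  by rewrite -[X in measurable X]setTI; exact: measurable_fst.
have -> : @rV_coord R d.+1 (inord i) \o rV_cons = @rV_coord R d j \o snd.
  apply/funext => x /=; rewrite /rV_coord /rV_cons.
  have -> : (inord i : 'I_(1 + d)) = rshift 1 j by apply/val_inj.
  exact: (row_mxEr (const_mx x.1) x.2 ord0 j).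
rewrite comp_preimage -[X in measurable X]setTI.
apply: measurable_snd => //.
by rewrite -[X in measurable X]setTI; exact: measurable_rV_coord.
Qed.

Lemma measurable_rV_behead :
  measurable_fun setT (fun x : 'rV[R]_(1 + d) => rsubmx x).
Proof.
apply: (@measurability _ _ _ _ _ _ (\big[setU/set0]_(i < d)
  preimage_set_system setT (@rV_coord R d i) measurable)) => //.
rewrite -bigcup_seq => _ [B [i Id [A mA <-] <-]].
rewrite (_ : _ `&` _ = setT `&` @rV_coord R (1 + d) (rshift 1 i) @^-1` A).
  exact: measurable_rV_coord.
by rewrite !setTI; apply/funext => x; rewrite /rV_coord /= mxE.
Qed.

Variable m : {sigma_finite_measure set 'rV[R]_d -> \bar R}.

Definition lebesgue_step : set 'rV[R]_d.+1 -> \bar R :=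
  pushforward (@lebesgue_measure R \x m)%E rV_cons.

Let pfm : {measure set 'rV[R]_d.+1 -> \bar R} :=
  measure_function_pushforward__canonical__measure_function_Measure
    (@lebesgue_measure R \x m)%E measurable_rV_cons.

HB.instance Definition _ := isMeasure.Build _ _ _ lebesgue_step
  (measure0 pfm) (measure_ge0 pfm) (@measure_semi_sigma_additive _ _ _ pfm).

Let lebesgue_step_sigma_finite : sigma_finite setT lebesgue_step.
Proof.
have /sigma_finiteP[F [FT ndF Foo]] := sigma_finiteT (@lebesgue_measure R).
have /sigma_finiteP[G [GT ndG Goo]] := sigma_finiteT m.
pose uncons (y : 'rV[R]_(1 + d)) : measurableTypeR R * 'rV[R]_d :=
  (@rV_coord R (1 + d) ord0 y, rsubmx y).
have muncons : measurable_fun setT uncons.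
  apply/measurable_fun_pair; first exact: measurable_rV_coord.
  exact: measurable_rV_behead.
have consK x : uncons (rV_cons x) = x.
  case: x => a b; congr pair; last exact: row_mxKr.
  rewrite /rV_coord /rV_cons /=.
  have -> : (ord0 : 'I_(1 + d)) = lshift d ord0 by apply/val_inj.
  by apply: etrans (row_mxEl (const_mx a) b ord0 ord0) _; rewrite mxE.
exists (fun n => uncons @^-1` (F n `*` G n)).
  rewrite -preimage_bigcup -[LHS](preimage_setT uncons); congr preimage.
  rewrite -setXTT FT GT predeqE => -[x y]; split.
    move=> [/= [n _ Fnx] [k _ Gky]]; exists (maxn n k) => //; split.
    - by move: x Fnx; exact/subsetPset/ndF/leq_maxl.
    - by move: y Gky; exact/subsetPset/ndG/leq_maxr.
  by move=> [n _ []/= ? ?]; split; exists n.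
move=> n; have [mF Fn] := Foo n; have [mG Gn] := Goo n; split.
  by rewrite -[X in measurable X]setTI; apply: muncons => //; exact: measurableX.
rewrite /lebesgue_step /pushforward.
rewrite (_ : _ @^-1` _ = F n `*` G n); last first.
  transitivity ((uncons \o rV_cons) @^-1` (F n `*` G n)) => //.
  by rewrite (_ : _ \o _ = id)//; apply/funext => x; exact: consK.
by rewrite product_measure1E// lte_mul_pinfty// ge0_fin_numE.
Qed.

HB.instance Definition _ := @Measure_isSigmaFinite.Build _ _ _
  lebesgue_step lebesgue_step_sigma_finite.

End rV_cons.

(* d-fold product of the Lebesgue measure of the line. *)
Fixpoint leb (R : realType) (d : nat) :
    {sigma_finite_measure set 'rV[R]_d -> \bar R} :=
  match d with
  | 0 => (\d_(0 : 'rV[R]_0) : {sigma_finite_measure set 'rV[R]_0 -> \bar R})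
  | d'.+1 => lebesgue_step (leb R d')
  end.

Section euclid.
Context (R : realType) (d : nat).
Local Notation E := 'rV[R]_d.
Local Notation M := 'M[R]_d.

(* The library's norm on matrices is the sup norm. *)
Definition dotp (x y : E) : R := \sum_i x ord0 i * y ord0 i.
Definition enorm (x : E) : R := Num.sqrt (dotp x x).

Definition frob (A B : M) : R := \sum_i \sum_j A i j * B i j.
Definition fnorm (A : M) : R := Num.sqrt (frob A A).

Definition diameter (A : set E) : R :=
  sup [set enorm (x - y) | x in A & y in A].

(* (diam A)^s (0 if A is empty) if diam A <= delta, and +oo otherwise. *)
Definition hausdorff_gauge (s : nat) (delta : R) (A : set E) : \bar R :=
  if `[< forall x y, A x -> A y -> enorm (x - y) <= delta >] then
    maxe 0%E (ereal_sup [set (enorm (x - y) ^+ s)%:E | x in A & y in A])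
  else +oo%E.

(* Hausdorff outer measure of dimension s, without the usual normalising
   factor: only its null sets and the associated L^2 convergence are used.
   [mu_ext] takes the infimum over countable covers by Borel sets: this
   is no restriction since a set and its closure have the same diameter. *)
Definition hausdorff (s : nat) (A : set E) : \bar R :=
  ereal_sup [set mu_ext (hausdorff_gauge s delta) A | delta in [set t | 0 < t]].

Let gauge0 s delta : hausdorff_gauge s delta set0 = 0%E.
Proof.
rewrite /hausdorff_gauge asboolT//.
by rewrite (_ : image2 _ _ _ = set0) ?ereal_sup0 ?maxNye ?maxeNy//;
  apply/seteqP; split => x // [].
Qed.

Let gauge_ge0 s delta A : (0 <= hausdorff_gauge s delta A)%E.
Proof. by rewrite /hausdorff_gauge; case: ifPn; rewrite ?leey// le_max lexx. Qed.

Let hausdorff_ge0 s A : (0 <= hausdorff s A)%E.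
Proof.
apply: le_ereal_sup_tmp; exists (mu_ext (hausdorff_gauge s 1) A).
  by exists 1 => //=; exact: ltr01.
exact: mu_ext_ge0.
Qed.

Let hausdorff0 s : hausdorff s set0 = 0%E.
Proof.
apply/eqP; rewrite eq_le hausdorff_ge0 andbT.
by apply: ge_ereal_sup => _ [delta _ <-]; rewrite mu_ext0.
Qed.

Let le_hausdorff s : {homo hausdorff s : A B / A `<=` B >-> (A <= B)%E}.
Proof.
move=> A B AB; apply: ge_ereal_sup => _ [delta d0 <-].
apply: le_ereal_sup_tmp; exists (mu_ext (hausdorff_gauge s delta) B).
  by exists delta.
exact: le_mu_ext.
Qed.

Let hausdorff_sigma_subadditive s : sigma_subadditive (hausdorff s).
Proof.
move=> A; apply: ge_ereal_sup => _ [delta d0 <-].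
apply: le_trans; first exact: mu_ext_sigma_subadditive.
apply: lee_nneseries => [i _ _|i _].
  exact: (mu_ext_ge0 (gauge_ge0 s delta)).
by apply: ereal_sup_ubound; exists delta.
Qed.

HB.instance Definition _ s := isOuterMeasure.Build R E (hausdorff s)
  (hausdorff0 s) (hausdorff_ge0 s) (@le_hausdorff s)
  (hausdorff_sigma_subadditive s).

End euclid.

Section domain.
Context (R : realType) (d : nat).
Local Notation E := 'rV[R]_d.

Definition boundary (A : set E) : set E := closure A `\` A°.

(* Near each boundary point, Omega is the subgraph in direction e of a
   Lipschitz function of the component orthogonal to e. *)
Definition lipschitz_boundary (Omega : set E) :=
  forall x, boundary Omega x ->
  exists (r : R) (e : E) (gamma : E -> R) (L : R),
  [/\ 0 < r, enorm e = 1,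
      forall y z, `|gamma y - gamma z| <= L * enorm (y - z) &
      forall y, enorm (y - x) < r ->
        (Omega y <-> dotp y e < gamma (y - dotp y e *: e))].

Definition lipschitz_domain (Omega : set E) :=
  [/\ Omega !=set0, open Omega, connected Omega, bounded_set Omega &
      lipschitz_boundary Omega].

End domain.

Section spaces.
Context (R : realType) (d : nat).
Local Notation E := 'rV[R]_d.
Local Notation M := 'M[R]_d.

Definition in_L2 {disp} {T : measurableType disp} (mu : set T -> \bar R)
    (D : set T) (f : T -> R) :=
  measurable_fun D f /\ (\int[mu]_(x in D) ((f x) ^+ 2)%:E < +oo)%E.

Definition pd (j : 'I_d) (f : E -> R) : E -> R :=
  fun x => 'D_(delta_mx ord0 j) f x.

Definition jac (f : E -> E) (x : E) : M :=
  \matrix_(i, j) pd j (fun y => f y ord0 i) x.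

Definition smooth (f : E -> R) :=
  forall s : seq 'I_d, let g := foldr pd f s in
  continuous g /\ forall x j, derivable g x (delta_mx ord0 j).

Definition test_function (Omega : set E) (phi : E -> R) :=
  smooth phi /\
  exists K, [/\ compact K, K `<=` Omega & forall x, ~ K x -> phi x = 0].

Definition weak_gradient (Omega : set E) (v : E -> E) (G : E -> M) :=
  forall phi, test_function Omega phi -> forall i j,
  \int[leb R d]_(x in Omega) (v x ord0 i * pd j phi x) =
  - \int[leb R d]_(x in Omega) (G x i j * phi x).

(* An element of H^1(Omega, R^d) is carried together with its weak gradient,
   which it determines almost everywhere: v.1 is the function, v.2 x i j is the
   weak derivative of its i-th component in direction j. Functions are defined
   on all of R^d but only their values on Omega matter. *)
Local Notation field := ((E -> E) * (E -> M))%type.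

Definition H1 (Omega : set E) : set field :=
  [set v : field | [/\ forall i, in_L2 (leb R d) Omega (fun x => v.1 x ord0 i),
               forall i j, in_L2 (leb R d) Omega (fun x => v.2 x i j) &
               weak_gradient Omega v.1 v.2]].

Definition H1_density (v : field) (x : E) : R :=
  dotp (v.1 x) (v.1 x) + frob (v.2 x) (v.2 x).

Definition H1_norm (Omega : set E) (v : field) : R :=
  Num.sqrt (\int[leb R d]_(x in Omega) H1_density v x).

Local Notation surface := (hausdorff d.-1 : set E -> \bar R).

Definition surface_measure :
  set (caratheodory_type surface) -> \bar R := surface.

(* w is the trace of v on the boundary: the L^2(boundary) limit of the
   restrictions of smooth functions converging to v in H^1(Omega). *)
Definition is_trace (Omega : set E) (v : field) (w : E -> E) :=
  (forall i, in_L2 surface_measure (boundary Omega) (fun x => w x ord0 i)) /\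
  exists phi : nat -> E -> E,
  [/\ forall n i, smooth (fun x => phi n x ord0 i),
      (fun n => \int[leb R d]_(x in Omega)
         (H1_density ((phi n, jac (phi n)) - v) x)%:E)%E @ \oo --> 0%E &
      (fun n => \int[surface_measure]_(x in boundary Omega)
         (dotp (phi n x - w x) (phi n x - w x))%:E)%E @ \oo --> 0%E].

Definition V (Omega GammaD : set E) : set field :=
  [set v : field | H1 Omega v /\ exists w, is_trace Omega v w /\
     surface [set x : E | GammaD x /\ w x <> 0] = 0%E].

Definition sym0 : set M := [set t : M | t^T = t /\ \tr t = 0].

Definition Q (Omega : set E) : set (E -> M) :=
  [set q : E -> M | (forall i j, in_L2 (leb R d) Omega (fun x => q x i j)) /\
     {ae leb R d, forall x, Omega x -> sym0 (q x)}].

Definition linear_on {U : lmodType R} (S : set U) (f : U -> R) :=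
  forall c u v, S u -> S v -> f (c *: u + v) = c * f u + f v.

Definition in_Vdual (Omega GammaD : set E) (f : field -> R) :=
  linear_on (V Omega GammaD) f /\
  exists c, forall v, V Omega GammaD v -> `|f v| <= c * H1_norm Omega v.

Definition GammaN (Omega GammaD : set E) := boundary Omega `\` closure GammaD.

Definition is_traceN (Omega GammaD : set E) (v : field) (w : E -> E) :=
  exists w0, is_trace Omega v w0 /\
    surface [set x : E | GammaN Omega GammaD x /\ w x <> w0 x] = 0%E.

Definition tracesN (Omega GammaD : set E) : set (E -> E) :=
  [set w : E -> E | exists2 v, V Omega GammaD v & is_traceN Omega GammaD v w].

(* Continuity is with respect to the quotient norm
   inf {|v|_{H^1} : v in V with trace w on GammaN}. *)
Definition in_tracesN_dual (Omega GammaD : set E) (g : (E -> E) -> R) :=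
  linear_on (tracesN Omega GammaD) g /\
  exists c, forall v w, V Omega GammaD v -> is_traceN Omega GammaD v w ->
    `|g w| <= c * H1_norm Omega v.

Definition traceN (Omega GammaD : set E) (v : field) : E -> E :=
  xget 0 [set w : E -> E | is_traceN Omega GammaD v w].

Definition load (Omega GammaD : set E) (f : field -> R) (g : (E -> E) -> R)
    (v : field) : R :=
  f v + g (traceN Omega GammaD v).

End spaces.

Section plasticity.
Context (R : realType) (d : nat).
Local Notation E := 'rV[R]_d.
Local Notation M := 'M[R]_d.
Local Notation field := ((E -> E) * (E -> M))%type.

Definition ip (Omega : set E) (A B : E -> M) : R :=
  \int[leb R d]_(x in Omega) frob (A x) (B x).

Definition tensor4 : Type := 'I_d -> 'I_d -> 'I_d -> 'I_d -> E -> R.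

Definition tapp (C : tensor4) (q : E -> M) : E -> M :=
  fun x => \matrix_(i, j) \sum_k \sum_l C i j k l x * q x k l.

Definition in_Loo (Omega : set E) (f : E -> R) :=
  measurable_fun Omega f /\
  exists c, {ae leb R d, forall x, Omega x -> `|f x| <= c}.

Definition admissible_tensor (Omega : set E) (S : set M) (c : R)
    (C : tensor4) :=
  [/\ forall i j k l, in_Loo Omega (C i j k l),
      {ae leb R d, forall x, Omega x -> forall i j k l,
         C i j k l x = C j i l k x /\ C i j k l x = C k l i j x} &
      {ae leb R d, forall x, Omega x -> forall t, S t ->
         frob (tapp C (fun=> t) x) t >= c * fnorm t ^+ 2}].

Definition sym : set M := [set t : M | t^T = t].

Definition strain (v : field) : E -> M :=
  fun x => 2^-1 *: (v.2 x + (v.2 x)^T).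

Definition sigma (C : tensor4) (v : field) (q : E -> M) : E -> M :=
  tapp C (strain v - q).

Definition aform (Omega : set E) (C H : tensor4)
    (vq wt : field * (E -> M)) : R :=
  ip Omega (sigma C vq.1 vq.2) (strain wt.1 - wt.2)
  + ip Omega (tapp H vq.2) wt.2.

Definition dev (t : M) : M := t - (\tr t / d%:R)%:M.

End plasticity.

Section discretization.
Context (R : realType) (d : nat).
Local Notation E := 'rV[R]_d.
Local Notation M := 'M[R]_d.
Local Notation field := ((E -> E) * (E -> M))%type.

Definition refcube : set E := [set x | forall i, -1 <= x ord0 i <= 1].
Definition refcubeo : set E := [set x | forall i, -1 < x ord0 i < 1].

(* On D, f is a polynomial of degree at most r in each variable. *)
Definition polyQ (r : nat) (D : set E) (f : E -> R) :=
  exists c : {ffun 'I_d -> 'I_r.+1} -> R, forall x, D x ->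
    f x = \sum_m c m * \prod_i x ord0 i ^+ m i.

Definition element (F : E -> E) : set E := F @` refcube.

(* Finite family of elements T given by their element mappings F T and
   polynomial degrees p T. kappa is a common constant for shape regularity, local
   quasi-uniformity and comparability of the degrees; the size of an element is
   its diameter. Hanging nodes are not excluded. *)
Record hp_mesh (kappa : R) (Omega : set E) (Th : finType)
    (F : Th -> E -> E) (p : Th -> nat) : Prop := HpMesh {
  mesh_Q1 : forall T i, polyQ 1 setT (fun x => F T x ord0 i) ;
  mesh_inj : forall T, set_inj refcube (F T) ;
  mesh_convex : forall T,
    convex_set (element (F T) : set (convex_lmodType E)) ;
  mesh_cover : closure Omega = \bigcup_(T in [set: Th]) element (F T) ;
  mesh_disj : forall T T', T != T' ->
    (element (F T))° `&` (element (F T'))° = set0 ;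
  mesh_shape : forall T x, refcube x ->
    [/\ jac (F T) x \in unitmx,
        fnorm (jac (F T) x) <= kappa * diameter (element (F T)) &
        fnorm (invmx (jac (F T) x)) <= kappa / diameter (element (F T))] ;
  mesh_quasi_uniform : forall T T',
    element (F T) `&` element (F T') !=set0 ->
    diameter (element (F T)) <= kappa * diameter (element (F T')) ;
  mesh_deg_ge1 : forall T, (1 <= p T)%N ;
  mesh_deg_comparable : forall T T',
    element (F T) `&` element (F T') !=set0 ->
    (p T)%:R <= kappa * (p T')%:R }.

Section spaces.
Context (Omega GammaD : set E) (Th : finType) (F : Th -> E -> E) (p : Th -> nat).

(* Piecewise polynomials are required to agree with the pulled-back polynomial
   at every point of the open elements; this fixes their values at the
   quadrature points. *)
Definition Vhp : set field :=
  [set v : field | V Omega GammaD v /\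
     forall T i, polyQ (p T) refcubeo (fun x => v.1 (F T x) ord0 i)].

Definition Qhp : set (E -> M) :=
  [set q : E -> M | Q Omega q /\
     forall T i j, polyQ (p T).-1 refcubeo (fun x => q (F T x) i j)].

Definition Php (m : E -> M) : E -> M :=
  xget 0 [set l : E -> M | Qhp l /\ forall q, Qhp q -> ip Omega (m - l) q = 0].

End spaces.

(* Exactness up to degree 2n - 1 with n nodes determines the Gauss rule up to
   the numbering of its nodes. *)
Definition gauss_rule (n : nat) (x w : 'I_n -> R) :=
  [/\ injective x, forall k, -1 < x k < 1, forall k, 0 < w k &
      forall P : {poly R}, (size P <= 2 * n)%N ->
        \sum_k w k * P.[x k] =
        \int[@lebesgue_measure R]_(t in `[-1, 1]) P.[t]].

Section quadrature.
Context (gx gw : forall n, 'I_n -> R).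

(* The n^d tensor product points are indexed by k : 'I_d -> 'I_n. *)
Definition gauss_point (n : nat) (k : {ffun 'I_d -> 'I_n}) : E :=
  \row_i gx (k i).

Definition gauss_weight (n : nat) (k : {ffun 'I_d -> 'I_n}) : R :=
  \prod_i gw (k i).

Definition quad (F : E -> E) (n : nat) (phi : E -> R) : R :=
  if n == 1%N then fine (leb R d (element F)) * phi (F 0)
  else \sum_(k : {ffun 'I_d -> 'I_n})
         gauss_weight k * `|\det (jac F (gauss_point k))|
         * phi (F (gauss_point k)).

Context (Th : finType) (F : Th -> E -> E) (p : Th -> nat) (sigma_y : R).

Definition psihp (q : E -> M) : R :=
  \sum_T quad (F T) (p T) (fun x => sigma_y * fnorm (q x)).

Definition Lambdahp (Omega : set E) : set (E -> M) :=
  [set m : E -> M | Qhp Omega F p m /\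
     forall q, Qhp Omega F p q -> ip Omega m q <= psihp q].

End quadrature.

End discretization.

(* Main.v *)
Require Import Defs.
From HB Require Import structures.
From mathcomp Require Import all_boot all_order all_algebra.
From mathcomp Require Import all_classical all_reals all_analysis.
From mathcomp Require Import measurable_realfun.
From mathcomp Require Import ring lra.

Set Implicit Arguments.
Unset Strict Implicit.
Unset Printing Implicit Defensive.

Import Order.TTheory GRing.Theory Num.Theory.
Import numFieldNormedType.Exports.

Local Open Scope classical_set_scope.
Local Open Scope ring_scope.

(** Write sigma for the stress of (u, q). The bilinear form splits as

      a((u, q), (v, r)) = (sigma, eps(v)) - (dev (sigma - H q), r),

    because r is symmetric and trace-free, and projecting the second factor
    onto Qhp turns the last term into (lambda, r). Since v and r vary
    independently, the variational inequality says two things: testing with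
    u + v and u - v gives the equilibrium equation (sigma, eps(v)) = ell(v), and
    testing with r gives (lambda, r) - (lambda, q) <= psi(r) - psi(q) for all r.
    As psi is positively homogeneous, r = 0 and r = 2 q yield
    (lambda, q) = psi(q) and hence (lambda, r) <= psi(r). These are the membership
    of lambda in Lambda and the flow rule of the mixed problem.

    Conversely the mixed problem gives the inequality as soon as
    psi(q) <= (lambda, q), that is, as soon as psi(q) is attained by some member
    of Lambda ([psihp_attained]). The functional sending r to the quadrature of
    sigma_y (q / |q|) : r is at most psi(r), with equality at q, so its Riesz
    representative in Qhp is such a member. Equality of lambda with the
    projection follows by testing the mixed problem with (0, r).

    Three facts carry this argument.

    - Riesz representation in Qhp ([Qhp_riesz]) and existence of the projection
      ([Php_spec]). Functions are not identified up to null sets, so the L^2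
      product is only semidefinite and Qhp, whose members are arbitrary on the
      mesh skeleton, is not finite dimensional. Its members vanishing off the
      open elements form a finite dimensional space ([Qhp_finite_span]), and a
      functional that kills the degenerate vectors is representable there
      ([riesz_span]).

    - Quadrature kills the degenerate vectors ([polyQ_ae0]): a member of Qhp
      that is zero almost everywhere vanishes at every quadrature node. This
      rests on the element mappings being open inside the reference cube
      ([sloped_locally_open], by a contraction argument) and on nonempty open
      sets having positive Lebesgue measure.

    - V is a linear space and ell is linear on it ([V_comb], [load_comb]). A
      linear combination of L^2 limits on the boundary is controlled by an
      integral of a sum, which requires smooth functions to be measurable for
      the surface measure; this is the Caratheodory criterion for the Hausdorff
      outer measure ([hausdorff_borel]). The boundary load is bounded by the H^1 norm of
      any extension, so it takes the same value at all traces of a field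
      ([dual_traceN_unique]). *)

(** * Borel sets and Lebesgue measure on row vectors *)

Lemma rV_normP (R : realType) (d : nat) (x : 'rV[R]_d) (e : R) : 0 <= e ->
  (`|x| <= e) = [forall i, `|x ord0 i| <= e].
Proof.
move=> e0; rewrite [X in X <= _](mx_normrE x); apply/bigmax_leP/forallP => /=.
  by move=> [_ H] i; exact: (H (ord0, i)).
by move=> H; split=> // -[i j] _ /=; rewrite ord1.
Qed.

Lemma rV_coord_norm (R : realType) (d : nat) (x : 'rV[R]_d) i :
  `|x ord0 i| <= `|x|.
Proof. by have := lexx `|x|; rewrite {1}rV_normP// => /forallP. Qed.

(** Closed boxes, rather than open balls, because the norm is the sup norm and
    the measure of a box is explicit. *)
Lemma nbhs_rV_box (R : realType) (d : nat) (x : 'rV[R]_d) (A : set 'rV[R]_d) :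
  nbhs x A <-> exists2 e : R, 0 < e &
    forall y : 'rV[R]_d, (forall i, `|y ord0 i - x ord0 i| <= e) -> A y.
Proof.
split.
  move=> /nbhs_ballP[e /= e0 eA]; exists (e / 2); first by rewrite divr_gt0.
  move=> y xy; apply: eA; rewrite -ball_normE /= distrC.
  apply: (@le_lt_trans _ _ (e / 2)); last by rewrite ltr_pdivrMr// ltr_pMr// ltr1n.
  rewrite rV_normP; last by rewrite divr_ge0// ltW.
  by apply/forallP => i; rewrite !mxE.
move=> [e e0 eA]; apply/nbhs_ballP; exists e => //= y.
rewrite -ball_normE /= distrC => /ltW; rewrite rV_normP; last exact: ltW.
by move=> /forallP H; apply: eA => i; have := H i; rewrite !mxE.
Qed.

Lemma measurable_rV_cylinders (R : realType) (d : nat) (I : 'I_d -> set R) :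
  (forall i, measurable (I i : set (measurableTypeR R))) ->
  measurable [set y : 'rV[R]_d | forall i, I i (y ord0 i)].
Proof.
move=> mI; rewrite (_ : mkset _ = \bigcap_i (@rV_coord R d i @^-1` I i)).
  apply: fin_bigcap_measurable => [|i _]; first exact: finite_finset.
  by rewrite -[X in measurable X]setTI; exact: measurable_rV_coord.
by apply/seteqP; split => [y H i _|y H i]; [exact: H|exact: (H i Logic.I)].
Qed.

(** An open set is the countable union of the rational boxes that it contains. *)
Lemma open_rV_measurable (R : realType) (d : nat) (A : set 'rV[R]_d) :
  open A -> measurable A.
Proof.
move=> oA.
pose r (n : nat) : R := n.+1%:R^-1.
pose box (k : {ffun 'I_d -> rat} * nat) : set 'rV[R]_d :=
  [set y | forall i, `|y ord0 i - ratr (k.1 i)| < r k.2].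
have mbox k : measurable (box k).
  apply: (@measurable_rV_cylinders R d (fun i => [set t | `|t - ratr (k.1 i)| < r k.2])).
  move=> i; rewrite (_ : mkset _ =
    `]ratr (k.1 i) - r k.2, ratr (k.1 i) + r k.2[%classic).
    exact: measurable_itv.
  by apply/seteqP; split => t /=; rewrite in_itv /= ltr_distl.
have -> : A = \bigcup_k (if `[< box k `<=` A >] then box k else set0).
  apply/seteqP; split => [x Ax|x [k _]]; last first.
    by case: asboolP => // H; exact: H.
  have /nbhs_rV_box[e e0 eA] : nbhs x A by exact: open_nbhs_nbhs.
  have [n nlt] : exists n, r n < e / 2.
    have e2 : 0 < e / 2 by rewrite divr_gt0.
    exists (Num.bound (e / 2)^-1); rewrite /r -[ltRHS]invrK ltf_pV2 ?posrE ?invr_gt0//.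
    apply: (lt_le_trans (archi_boundP _)); first by rewrite invr_ge0 ltW.
    by rewrite ler_nat.
  have r0 : 0 < r n by rewrite /r invr_gt0.
  have /choice[q qP] : forall i, exists q : rat, `|x ord0 i - ratr q| < r n.
    move=> i; have : x ord0 i - r n < x ord0 i + r n by rewrite ltrD2l gtrN.
    move=> /rat_in_itvoo[q]; rewrite in_itv /= => /andP[q1 q2]; exists q.
    by rewrite ltr_distlC; apply/andP; split; lra.
  exists ([ffun i => q i], n) => //.
  have -> : `[< box ([ffun i => q i], n) `<=` A >].
    apply/asboolP => y yb; apply: eA => i.
    have := yb i; have := qP i; rewrite /= ffunE.
    rewrite ltr_norml => /andP[? ?]; rewrite ltr_norml => /andP[? ?].
    by rewrite ler_norml; apply/andP; split; lra.
  by move=> i; rewrite /= ffunE; exact: qP.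
apply: countable_bigcupT_measurable; first exact: countableP.
by move=> k; case: ifP => // _.
Qed.

Lemma continuous_rV_preimage (R : realType) (d : nat) (f : 'rV[R]_d -> R)
  (B : set R) : continuous f -> measurable B -> measurable (f @^-1` B).
Proof.
move=> cf mB.
have mf : measurable_fun setT (f : 'rV[R]_d -> measurableTypeR R).
  apply: (measurability _ (RGenOpens.measurableE R)) => _ [_ [a [b ->] <-]].
  rewrite setTI; apply: open_rV_measurable.
  by move/continuousP : cf; apply; exact: interval_open.
by rewrite -[X in measurable X]setTI; exact: mf.
Qed.

Lemma continuous_rV_measurable_fun (R : realType) (d : nat) (D : set 'rV[R]_d)
  (f : 'rV[R]_d -> R) : continuous f -> measurable_fun D f.
Proof.
by move=> cf mD B mB; apply: measurableI => //; exact: continuous_rV_preimage.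
Qed.

(** The measure of a box is a product of lengths; what matters below is only
    that it is finite and positive. *)
Lemma leb_box (R : realType) (d : nat) (x : 'rV[R]_d) (r : R) : 0 < r ->
  exists2 c : R, 0 < c &
  leb R d [set y : 'rV[R]_d | forall i, `|y ord0 i - x ord0 i| <= r] = c%:E.
Proof.
move=> r0; elim: d x => [|d IH] x.
  exists 1 => //=; rewrite diracE mem_set//.
  by move=> [].
have [c c0 cE] := IH (rsubmx (x : 'rV[R]_(1 + d))).
exists (2 * r * c); first by rewrite !mulr_gt0.
rewrite /= /lebesgue_step /pushforward.
pose I : set R := `[x ord0 ord0 - r, x ord0 ord0 + r]%classic.
set B := [set y | _] in cE.
have -> : @rV_cons R d @^-1` [set y : 'rV[R]_d.+1 | forall i, `|y ord0 i - x ord0 i| <= r] =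
    I `*` B.
  have El a b : @rV_cons R d (a, b) ord0 ord0 = a.
    rewrite /rV_cons; have -> : (ord0 : 'I_(1 + d)) = lshift d ord0 by apply/val_inj.
    by apply: etrans (row_mxEl (const_mx a) b ord0 ord0) _; rewrite mxE.
  have shiftE j : lift ord0 j = rshift 1 j :> 'I_(1 + d) by apply/val_inj.
  have Er a b j : @rV_cons R d (a, b) ord0 (lift ord0 j) = b ord0 j.
    by rewrite /rV_cons shiftE; exact: (row_mxEr (const_mx a) b ord0 j).
  have xE j : rsubmx (x : 'rV[R]_(1 + d)) ord0 j = x ord0 (lift ord0 j).
    by rewrite mxE -shiftE.
  apply/seteqP; split => [[a b] /= H|[a b] /= [Ha Hb] i].
    split; first by have := H ord0; rewrite El ler_distl /I /= in_itv.
    by move=> i; rewrite xE; have := H (lift ord0 i); rewrite Er.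
  case: (unliftP ord0 i) => [j|] ->; last first.
    by rewrite El ler_distl; move: Ha; rewrite /I /= in_itv.
  by rewrite Er; have := Hb j; rewrite xE.
have mB : measurable B.
  apply: (@measurable_rV_cylinders R d (fun i =>
    [set t | `|t - rsubmx (x : 'rV[R]_(1 + d)) ord0 i| <= r])) => i.
  rewrite (_ : mkset _ = `[rsubmx (x : 'rV[R]_(1 + d)) ord0 i - r,
    rsubmx (x : 'rV[R]_(1 + d)) ord0 i + r]%classic); first exact: measurable_itv.
  by apply/seteqP; split => t /=; rewrite in_itv /= ler_distl.
transitivity ((@lebesgue_measure R I) * (leb R d B))%E.
  by apply: product_measure1E => //; exact: measurable_itv.
rewrite cE /I lebesgue_measure_itv /= lte_fin.
rewrite ltrD2l gtrN// -EFinD -EFinM; congr _%:E.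
by lra.
Qed.

(** * Borel sets are Caratheodory measurable for the Hausdorff measure *)

Lemma coord_le_enorm (R : realType) (d : nat) (x : 'rV[R]_d) i :
  `|x ord0 i| <= enorm x.
Proof.
rewrite /enorm /dotp -sqrtr_sqr ler_wsqrtr// (bigD1 i)//= -expr2 lerDl.
by apply: sumr_ge0 => j _; rewrite -expr2 sqr_ge0.
Qed.

Lemma hausdorff_gauge_ge0 (R : realType) (d s : nat) (delta : R)
  (A : set 'rV[R]_d) : (0 <= hausdorff_gauge s delta A)%E.
Proof. by rewrite /hausdorff_gauge; case: ifPn; rewrite ?leey// le_max lexx. Qed.

Lemma hausdorff_gauge0 (R : realType) (d s : nat) (delta : R) :
  hausdorff_gauge s delta (@set0 'rV[R]_d) = 0%E.
Proof.
rewrite /hausdorff_gauge asboolT//.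
by rewrite (_ : image2 _ _ _ = set0) ?ereal_sup0 ?maxNye ?maxeNy//;
  apply/seteqP; split => x // [].
Qed.

(** When the admissible diameters are smaller than the distance t between A
    and B, no set of a cover meets both, so a cover of the union splits into a
    cover of A and a cover of B. *)
Lemma hausdorff_metric (R : realType) (d s : nat) (t : R)
  (A B : set 'rV[R]_d) : 0 < t ->
  (forall x y, A x -> B y -> t <= enorm (x - y)) ->
  (hausdorff s A + hausdorff s B <= hausdorff s (A `|` B))%E.
Proof.
move=> t0 AB.
pose m (e : R) (X : set 'rV[R]_d) := mu_ext (hausdorff_gauge s e) X.
have m_ge0 e X : (0 <= m e X)%E.
  by apply: mu_ext_ge0 => Y; exact: hausdorff_gauge_ge0.
have m_mono e e' X : e' <= e -> (m e X <= m e' X)%E.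
  move=> ee'; apply: le_ereal_inf_tmp => _ [F cF <-].
  apply: (@le_trans _ _ (\sum_(k <oo) hausdorff_gauge s e (F k))%E).
    by apply: ereal_inf_lbound; exists F.
  apply: lee_nneseries => [k _ _|k _]; first exact: hausdorff_gauge_ge0.
  rewrite /hausdorff_gauge; case: asboolP => h1; case: asboolP => h2//.
    by rewrite leey.
  by exfalso; apply: h1 => x y Fx Fy; apply: le_trans ee'; exact: h2.
have key e : 0 < e -> e < t -> (m e A + m e B <= m e (A `|` B))%E.
  move=> e0 et; apply: le_ereal_inf_tmp => _ [F [mF ABF] <-].
  pose G (X : set 'rV[R]_d) k := if `[< F k `&` X !=set0 >] then F k else set0.
  have mG X k : measurable (G X k) by rewrite /G; case: ifP => // _.
  have GX (X : set 'rV[R]_d) : X `<=` A `|` B -> (m e X <= \sum_(k <oo) hausdorff_gauge s e (G X k))%E.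
    move=> XAB; apply: ereal_inf_lbound; exists (G X) => //; split => // x Xx.
    have [k _ Fkx] := ABF _ (XAB _ Xx); exists k => //; rewrite /G.
    by case: asboolP => // H; exfalso; apply: H; exists x.
  apply: (@le_trans _ _ (\sum_(k <oo) (hausdorff_gauge s e (G A k) + hausdorff_gauge s e (G B k)))%E).
    rewrite nneseriesD; [|by move=> *; exact: hausdorff_gauge_ge0..].
    by apply: leeD; apply: GX => x ?; [left|right].
  apply: lee_nneseries => [k _ _|k _].
    by apply: adde_ge0; exact: hausdorff_gauge_ge0.
  rewrite /G; case: asboolP => hA; case: asboolP => hB;
    rewrite ?hausdorff_gauge0 ?adde0 ?add0e ?hausdorff_gauge_ge0//.
  move: hA hB => [x [Fx Ax]] [y [Fy By]].
  rewrite [leRHS]/hausdorff_gauge; case: asboolP => [h|]; last by rewrite leey.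
  by have := h _ _ Fx Fy; rewrite leNgt (lt_le_trans et)// AB.
have [->|Hfin] := eqVneq (hausdorff s (A `|` B)) +oo%E; first by rewrite leey.
have m_le e : 0 < e -> forall X, (m e X <= hausdorff s X)%E.
  by move=> e0 X; apply: ereal_sup_ubound; exists e.
have sub X : X `<=` A `|` B -> hausdorff s X \is a fin_num.
  move=> XAB; rewrite ge0_fin_numE; last exact: outer_measure_ge0.
  apply: (@le_lt_trans _ _ (hausdorff s (A `|` B))); first exact: le_outer_measure.
  by rewrite ltey.
have fA : hausdorff s A \is a fin_num by apply: sub => x ?; left.
have fB : hausdorff s B \is a fin_num by apply: sub => x ?; right.
have fm e : 0 < e -> forall X, hausdorff s X \is a fin_num -> m e X \is a fin_num.
  move=> e0 X fX; rewrite ge0_fin_numE//; apply: (le_lt_trans (m_le _ e0 X)).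
  by rewrite -ge0_fin_numE//; exact: outer_measure_ge0.
rewrite -leeBrDr//; apply: ge_ereal_sup => _ [e1 /= e10 <-].
rewrite leeBrDr// addeC -leeBrDr ?(fm e1)//.
apply: ge_ereal_sup => _ [e2 /= e20 <-].
rewrite leeBrDr ?(fm e1)//.
pose e := Num.min (t / 2) (Num.min e1 e2).
have e0 : 0 < e by rewrite !lt_min e10 e20 divr_gt0.
have et : e < t by rewrite /e gt_min ltr_pdivrMr// ltr_pMr// ltr1n.
apply: (@le_trans _ _ (m e A + m e B)%E).
  by rewrite addeC leeD// m_mono// !ge_min lexx !orbT.
by apply: le_trans (key e e0 et) _; exact: m_le.
Qed.

(** Cut the complement of the half-space into layers D n accumulating at its
    boundary. Layers of equal parity are at positive distance from each other,
    so the measures of the layers have bounded sums and the part of X within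
    distance r n of the half-space has measure tending to 0. The rest of X is at
    positive distance from the half-space, where additivity is known. *)
Lemma hausdorff_halfspace (R : realType) (d s : nat) (i : 'I_d) (a : R) :
  (@hausdorff R d s).-caratheodory [set x : 'rV[R]_d | x ord0 i <= a].
Proof.
set A := [set x | _]; apply: le_caratheodory_measurable => X.
pose H (Y : set 'rV[R]_d) := hausdorff s Y.
change (H (X `&` A) + H (X `&` ~` A) <= H X)%E.
have H0 Y : (0 <= H Y)%E by exact: outer_measure_ge0.
have [->|Hfin] := eqVneq (H X) +oo%E; first by rewrite leey.
have leH Y Z : Y `<=` Z -> (H Y <= H Z)%E by exact: le_outer_measure.
have fH Y : Y `<=` X -> H Y \is a fin_num.
  by move=> YX; rewrite ge0_fin_numE//; apply: le_lt_trans (leH _ _ YX) _; rewrite ltey.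
pose r (n : nat) : R := n.+1%:R^-1.
have r0 n : 0 < r n by rewrite invr_gt0.
have rS n : r n.+1 < r n by rewrite ltf_pV2 ?posrE// ltr_nat.
(* E exhausts the complement of A, staying at distance r n from A;
   D are its layers *)
pose E n := X `&` [set x : 'rV[R]_d | a + r n < x ord0 i].
pose D n := X `&` [set x : 'rV[R]_d | a + r n.+1 < x ord0 i <= a + r n].
have EX n : E n `<=` X by move=> x [].
have DX n : D n `<=` X by move=> x [].
have sep (b c : R) (Y Z : set 'rV[R]_d) : b < c -> (forall x, Y x -> x ord0 i <= b) ->
    (forall x, Z x -> c <= x ord0 i) -> (H Y + H Z <= H (Y `|` Z))%E.
  move=> bc Yb Zc; apply: (@hausdorff_metric _ _ _ (c - b)); first by rewrite subr_gt0.
  move=> x y Yx Zy; apply: le_trans (coord_le_enorm _ i).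
  rewrite !mxE distrC; apply: le_trans (ler_norm _).
  by apply: lerB; [exact: Zc|exact: Yb].
have sumD M : (\sum_(0 <= k < M.+1) H (D k) <= H (E M.+1) + H (E M))%E.
  elim: M => [|M IH].
    rewrite big_nat1; apply: le_trans (leeDl _ (H0 _)); apply: leH.
    by move=> x [Xx /= /andP[? _]].
  rewrite big_nat_recr//=.
  apply: (@le_trans _ _ (H (E M.+1) + (H (D M.+1) + H (E M)))%E).
    by rewrite (addeC (H (D _))) addeA leeD2r.
  rewrite addeC leeD2r//.
  apply: (@le_trans _ _ (H (D M.+1 `|` E M))); last first.
    apply: leH => x [[Xx /= /andP[? ?]]|[Xx /= ?]]; split => //=.
    by have := rS M; have := rS M.+1; lra.
  apply: (sep (a + r M.+1) (a + r M)); first by rewrite ltrD2l.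
    by move=> x [_ /= /andP[]].
  by move=> x [_ /= /ltW].
have sumfin : (\sum_(k <oo) H (D k) < +oo)%E.
  apply: (@le_lt_trans _ _ (H X + H X)%E); last first.
    by rewrite lte_add_pinfty// ltey.
  apply: lime_le; first by apply: is_cvg_nneseries.
  apply: nearW => n; apply: (@le_trans _ _ (\sum_(0 <= k < n.+1) H (D k))%E).
    by rewrite big_nat_recr//= leeDl.
  by apply: (le_trans (sumD _)); apply: leeD; apply: leH.
have tail := nneseries_tail_cvg sumfin (fun k _ => H0 (D k)).
have bound n : (H (X `&` A) + H (X `&` ~` A) <= H X + \sum_(n <= k <oo) H (D k))%E.
  apply: (@le_trans _ _ (H (X `&` A) + (H (E n) + \sum_(n <= k <oo) H (D k)))%E).
    rewrite leeD2l//; apply: (@le_trans _ _ (H (E n `|` \bigcup_(k in ~` `I_n) D k))).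
      apply: leH => x [Xx /= /negP]; rewrite -ltNge => ax.
      have [xn|xn] := ltP (a + r n) (x ord0 i); first by left.
      right; have : exists k, a + r k < x ord0 i.
        exists (Num.bound (x ord0 i - a)^-1); rewrite -ltrBrDl /r.
        rewrite -[ltRHS]invrK ltf_pV2 ?posrE ?invr_gt0 ?subr_gt0//.
        apply: (lt_le_trans (archi_boundP _)); last by rewrite ler_nat.
        by rewrite invr_ge0 subr_ge0 ltW.
      move=> ex; case: (ex_minnP ex) => -[|k] kx kmin.
        exfalso; have : r n <= r 0%N by rewrite lef_pV2 ?posrE// ler_nat.
        by move: kx xn; lra.
      exists k; last first.
        by split => //=; rewrite kx leNgt; apply/negP => /kmin; rewrite ltnn.
      rewrite /= => kn; have : r n <= r k.+1 by rewrite lef_pV2 ?posrE// ler_nat.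
      by move: kx xn; lra.
    apply: le_trans (outer_measureU2 _ _ _) _.
    by rewrite leeD2l//; exact: outer_measure_sigma_subadditive_tail.
  rewrite addeA leeD2r//; apply: (@le_trans _ _ (H ((X `&` A) `|` E n))); last first.
    by apply: leH => x [[]|[]].
  apply: (sep a (a + r n)); first by rewrite ltrDl.
    by move=> x [].
  by move=> x [_ /= /ltW].
have lim0 : (H X + \sum_(n <= k <oo) H (D k))%E @[n --> \oo] --> (H X + 0)%E.
  by apply: cvgeD => //; [rewrite fin_num_adde_defl|exact: cvg_cst].
rewrite -[H X]adde0 -(cvg_lim _ lim0)//.
by apply: lime_ge; [apply/cvg_ex; eexists; exact: lim0|exact: nearW].
Qed.

(** The Hausdorff outer measure separates sets at positive distance, so every
    half-space, hence every Borel set, is Caratheodory measurable. *)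
Lemma hausdorff_borel (R : realType) (d s : nat) (A : set 'rV[R]_d) :
  measurable A -> measurable (A : set (caratheodory_type (@hausdorff R d s))).
Proof.
apply: smallest_sub; first exact: sigma_algebra_measurable.
rewrite -bigcup_seq => _ [i _ [B mB <-]]; rewrite setTI.
have mc : measurable_fun setT
    (@rV_coord R d i : caratheodory_type (@hausdorff R d s) -> measurableTypeR R).
  apply: (measurability _ (RGenOInfty.measurableE R)).
  move=> _ [_ [a ->] <-]; rewrite setTI.
  rewrite (_ : _ @^-1` _ = ~` [set x : 'rV[R]_d | x ord0 i <= a]).
    by apply: measurableC; exact: hausdorff_halfspace.
  by apply/seteqP; split => x /=; rewrite in_itv /= andbT ltNge => /negP.
by rewrite -[X in measurable X]setTI; exact: mc.
Qed.

(** * Square integrable functions *)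

Section L2.
Context (dd : measure_display) (T : measurableType dd) (R : realType).
Variables (mu : {measure set T -> \bar R}) (D : set T).
Hypothesis mD : measurable D.
Implicit Types f g : T -> R.

Lemma measurable_sqr f : measurable_fun D f ->
  measurable_fun D (EFin \o (fun x => f x ^+ 2 : R)).
Proof. by move=> mf; apply/measurable_EFinP; exact: measurable_funX. Qed.

Lemma in_L2_le f g : measurable_fun D f -> in_L2 mu D g ->
  {ae mu, forall x, D x -> f x ^+ 2 <= g x ^+ 2} -> in_L2 mu D f.
Proof.
move=> mf [mg goo] fg; split => //; apply: le_lt_trans goo.
have pos (h : T -> R) x : D x -> (0 <= (h x ^+ 2)%:E)%E.
  by move=> _; rewrite lee_fin sqr_ge0.
apply: (ae_ge0_le_integral mD (pos f) (measurable_sqr mf) (pos g) (measurable_sqr mg)).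
by apply: filterS fg => x H Dx; rewrite lee_fin H.
Qed.

Lemma in_L2Z (c : R) f : in_L2 mu D f -> in_L2 mu D (fun x => c * f x).
Proof.
move=> [mf foo]; split; first exact: measurable_funM.
under eq_integral do rewrite exprMn EFinM.
rewrite ge0_integralZl//; last 3 first.
- exact: measurable_sqr.
- by move=> x _; rewrite lee_fin sqr_ge0.
- by rewrite lee_fin sqr_ge0.
by rewrite lte_mul_pinfty// lee_fin sqr_ge0.
Qed.

(** Uses (a + b)^2 <= 2 a^2 + 2 b^2, the defect being (a - b)^2. *)
Lemma in_L2D f g : in_L2 mu D f -> in_L2 mu D g ->
  in_L2 mu D (fun x => f x + g x).
Proof.
move=> [mf foo] [mg goo]; split; first exact: measurable_funD.
pose h x := (2 * f x ^+ 2 + 2 * g x ^+ 2)%:E : \bar R.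
have h0 (k : T -> R) x : D x -> (0 <= (2 * k x ^+ 2)%:E)%E.
  by move=> _; rewrite lee_fin mulr_ge0// sqr_ge0.
have mk (k : T -> R) : measurable_fun D k ->
    measurable_fun D (EFin \o (fun x => 2 * k x ^+ 2 : R)).
  move=> mk; apply/measurable_EFinP; apply: measurable_funM => //.
  exact: measurable_funX.
have ik (k : T -> R) : measurable_fun D k ->
    (\int[mu]_(x in D) (k x ^+ 2)%:E < +oo)%E ->
    (\int[mu]_(x in D) (2 * k x ^+ 2)%:E < +oo)%E.
  move=> mmk koo; under eq_integral do rewrite EFinM.
  rewrite ge0_integralZl//; last 2 first.
  - exact: measurable_sqr.
  - by move=> x _; rewrite lee_fin sqr_ge0.
  by rewrite lte_mul_pinfty.
apply: (@le_lt_trans _ _ (\int[mu]_(x in D) h x)%E).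
  apply: ge0_le_integral => //.
  - by move=> x _; rewrite lee_fin sqr_ge0.
  - by apply: measurable_sqr; exact: measurable_funD.
  - rewrite /h; under eq_fun do rewrite EFinD.
    by apply: emeasurable_funD; exact: mk.
  - move=> x _; rewrite lee_fin.
    by have := sqr_ge0 (f x - g x); nra.
rewrite /h; under eq_integral do rewrite EFinD.
rewrite ge0_integralD//; try (by move=> x; exact: h0); try exact: mk.
by rewrite lte_add_pinfty// ik.
Qed.

Lemma in_L2_0 : in_L2 mu D (fun=> 0).
Proof.
split; first exact: measurable_cst.
by rewrite integral0_eq// => x _; rewrite expr0n.
Qed.

Lemma in_L2_sum (I : finType) (f : I -> T -> R) : (forall i, in_L2 mu D (f i)) ->
  in_L2 mu D (fun x => \sum_i f i x).
Proof.
move=> fL; rewrite (_ : (fun _ => _) = \big[(fun a b x => a x + b x)/(fun=> 0)]_i f i).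
  elim/big_rec : _ => [|i h _ hL]; first exact: in_L2_0.
  exact: in_L2D.
by apply/funext => x; elim/big_rec2 : _ => // i a h _ ->.
Qed.

Lemma in_L2M_bounded (c : R) (h f : T -> R) : measurable_fun D h ->
  {ae mu, forall x, D x -> `|h x| <= c} ->
  in_L2 mu D f -> in_L2 mu D (fun x => h x * f x).
Proof.
move=> mh hc fL; have [mf _] := fL; apply: in_L2_le (in_L2Z c fL) _.
  exact: measurable_funM.
apply: filterS hc => x H Dx; rewrite !exprMn ler_wpM2r ?sqr_ge0//.
rewrite -[leLHS]real_normK ?num_real// ler_pXn2r ?nnegrE//; first exact: H.
by apply: le_trans (H Dx).
Qed.

Lemma in_L2_bounded (c : R) f : (mu D < +oo)%E -> measurable_fun D f ->
  (forall x, D x -> `|f x| <= c) -> in_L2 mu D f.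
Proof.
move=> Doo mf fc; apply: (@in_L2_le f (fun=> c)) => //.
  split; first exact: measurable_cst.
  rewrite integral_cst//; apply: lte_mul_pinfty => //.
  by rewrite lee_fin sqr_ge0.
apply: aeW => x Dx; rewrite -[leLHS]real_normK ?num_real//.
by rewrite ler_pXn2r ?nnegrE ?fc//; apply: le_trans (fc _ Dx).
Qed.

Lemma in_L2_integrableM f g : in_L2 mu D f -> in_L2 mu D g ->
  mu.-integrable D (EFin \o (fun x => f x * g x)).
Proof.
move=> [mf foo] [mg goo].
have isq (k : T -> R) : measurable_fun D k ->
    (\int[mu]_(x in D) (k x ^+ 2)%:E < +oo)%E ->
    mu.-integrable D (EFin \o (fun x => k x ^+ 2 : R)).
  move=> mk koo; apply/integrableP; split; first exact: measurable_sqr.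
  by under eq_integral do rewrite gee0_abs ?lee_fin ?sqr_ge0//.
apply: (le_integrable mD _ _ (integrableD mD (isq f mf foo) (isq g mg goo))).
- by apply/measurable_EFinP; exact: measurable_funM.
- move=> x _; change (`|f x * g x|%:E <= `|f x ^+ 2 + g x ^+ 2|%:E)%E.
  rewrite lee_fin normrM [leRHS]ger0_norm ?addr_ge0 ?sqr_ge0//.
  rewrite -(real_normK (num_real (f x))) -(real_normK (num_real (g x))).
  have := sqr_ge0 (`|f x| - `|g x|); have := sqr_ge0 (`|f x| + `|g x|).
  by nra.
Qed.

Lemma Rintegral_L2_comb (c : R) f g h :
  in_L2 mu D f -> in_L2 mu D g -> in_L2 mu D h ->
  \int[mu]_(x in D) ((c * f x + g x) * h x) =
  c * \int[mu]_(x in D) (f x * h x) + \int[mu]_(x in D) (g x * h x).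
Proof.
move=> Lf Lg Lh; have If := in_L2_integrableM Lf Lh.
have Ig := in_L2_integrableM Lg Lh.
rewrite -RintegralZl// -RintegralD//.
  by apply: eq_Rintegral => x _; rewrite mulrDl mulrA.
exact: (integrableZl mD c If).
Qed.

End L2.

(** * Smooth functions and the density of the H^1 norm *)

Section vanishing.
Context (dd : measure_display) (T : measurableType dd) (R : realType).
Variables (mu : {measure set T -> \bar R}) (D : set T).
Hypothesis mD : measurable D.

(** The squeeze behind every statement that a linear combination of two
    vanishing L^2 errors vanishes: w is the square of the combined error. *)
Lemma cvg_integral0_comb (k : R) (u v w : nat -> T -> R) : 0 <= k ->
  (forall n, measurable_fun D (u n)) -> (forall n, measurable_fun D (v n)) ->
  (forall n, measurable_fun D (w n)) ->
  (forall n x, 0 <= u n x) -> (forall n x, 0 <= v n x) ->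
  (forall n x, 0 <= w n x) ->
  (forall n x, w n x <= k * u n x + 2 * v n x) ->
  (fun n => \int[mu]_(x in D) (u n x)%:E)%E @ \oo --> 0%E ->
  (fun n => \int[mu]_(x in D) (v n x)%:E)%E @ \oo --> 0%E ->
  (fun n => \int[mu]_(x in D) (w n x)%:E)%E @ \oo --> 0%E.
Proof.
move=> k0 mu_ mv mw u0 v0 w0 wuv cu cv.
have mE (f : T -> R) : measurable_fun D f -> measurable_fun D (EFin \o f).
  by move=> mf; apply/measurable_EFinP.
have p0 (f : T -> R) : (forall x, 0 <= f x) -> forall x, D x -> (0 <= (f x)%:E)%E.
  by move=> f0 x _; rewrite lee_fin.
apply: (@squeeze_cvge _ _ _ _ (fun=> 0%E) _
  (fun n => k%:E * \int[mu]_(x in D) (u n x)%:E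
            + 2%:E * \int[mu]_(x in D) (v n x)%:E)%E).
- apply: nearW => n; apply/andP; split; first by apply: integral_ge0 => x; exact: p0.
  rewrite -ge0_integralZl ?lee_fin//; [|exact: mE|exact: p0].
  rewrite -ge0_integralZl ?lee_fin//; [|exact: mE|exact: p0].
  rewrite -ge0_integralD//.
  + apply: ge0_le_integral => //.
    * by move=> x; exact: (p0 _ (w0 n)).
    * exact: (mE _ (mw n)).
    * apply: emeasurable_funD; apply: measurable_funeM; exact: mE.
    * by move=> x _; rewrite -!EFinM -EFinD lee_fin.
  + by move=> x _; rewrite -EFinM lee_fin mulr_ge0.
  + by apply: measurable_funeM; exact: mE.
  + by move=> x _; rewrite -EFinM lee_fin mulr_ge0.
  + by apply: measurable_funeM; exact: mE.
- exact: cvg_cst.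
- rewrite -[X in _ --> X](_ : (k%:E * 0 + 2%:E * 0)%E = 0%E); last by rewrite !mule0 adde0.
  by apply: cvgeD; [rewrite !mule0|exact: cvgeZl|exact: cvgeZl].
Qed.

End vanishing.

Section smoothness.
Context (R : realType) (d : nat).
Local Notation E := 'rV[R]_d.
Implicit Types (f g : E -> R).

Lemma smooth_comb (c : R) f g : smooth f -> smooth g ->
  smooth (fun x => c * f x + g x).
Proof.
move=> sf sg.
have pdE s : foldr (@pd R d) (fun x => c * f x + g x) s =
    (fun x => c * foldr (@pd R d) f s x + foldr (@pd R d) g s x).
  elim: s => //= j s IH; rewrite IH; apply/funext => x; rewrite /pd.
  have [_ df] := sf s; have [_ dg] := sg s.
  rewrite (_ : (fun _ => _) = c *: foldr (@pd R d) f s + foldr (@pd R d) g s)//.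
  rewrite deriveD; [|by apply: derivableZ; exact: df|exact: dg].
  by rewrite deriveZ; [|exact: df].
move=> s /=; rewrite pdE.
have [cf df] := sf s; have [cg dg] := sg s; split.
  move=> x; have cfx := cf x; have cgx := cg x.
  exact: cvgD (cvgM (cvg_cst c) cfx) cgx.
move=> x j; rewrite (_ : (fun _ => _) = c *: foldr (@pd R d) f s + foldr (@pd R d) g s)//.
by apply: derivableD; [by apply: derivableZ; exact: df|exact: dg].
Qed.

Lemma smooth_continuous f : smooth f -> continuous f.
Proof. by move=> /(_ [::]) []. Qed.

Lemma smooth_pd_continuous f j : smooth f -> continuous (pd j f).
Proof. by move=> /(_ [:: j]) []. Qed.

Lemma jac_comb (c : R) (f g : E -> E) :
  (forall i, smooth (fun x => f x ord0 i)) ->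
  (forall i, smooth (fun x => g x ord0 i)) ->
  jac (c *: f + g) = c *: jac f + jac g.
Proof.
move=> sf sg; apply/funext => x; apply/matrixP => i j; rewrite !mxE /pd.
have [_ df] := sf i [::]; have [_ dg] := sg i [::].
rewrite (_ : (fun _ => _) = c *: (fun x => f x ord0 i) + (fun x => g x ord0 i));
  last by apply/funext => y; rewrite !mxE.
rewrite deriveD; [|by apply: derivableZ; exact: df|exact: dg].
by rewrite deriveZ; [|exact: df].
Qed.

End smoothness.

Section density.
Context (R : realType) (d : nat).
Local Notation E := 'rV[R]_d.
Local Notation M := 'M[R]_d.
Local Notation field := ((E -> E) * (E -> M))%type.

Lemma dotp_ge0 (x : E) : 0 <= dotp x x.
Proof. by apply: sumr_ge0 => i _; rewrite -expr2 sqr_ge0. Qed.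

Lemma frob_ge0 (A : M) : 0 <= frob A A.
Proof.
by apply: sumr_ge0 => i _; apply: sumr_ge0 => j _; rewrite -expr2 sqr_ge0.
Qed.

Lemma dotp_comb_le (c : R) (x y : E) :
  dotp (c *: x + y) (c *: x + y) <= 2 * c ^+ 2 * dotp x x + 2 * dotp y y.
Proof.
rewrite /dotp !mulr_sumr -big_split /=; apply: ler_sum => i _; rewrite !mxE.
by have := sqr_ge0 (c * x ord0 i - y ord0 i); nra.
Qed.

Lemma frob_comb_le (c : R) (A B : M) :
  frob (c *: A + B) (c *: A + B) <= 2 * c ^+ 2 * frob A A + 2 * frob B B.
Proof.
rewrite /frob !mulr_sumr -big_split /=; apply: ler_sum => i _.
rewrite !mulr_sumr -big_split /=; apply: ler_sum => j _; rewrite !mxE.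
by have := sqr_ge0 (c * A i j - B i j); nra.
Qed.

Lemma H1_density_ge0 (v : field) x : 0 <= H1_density v x.
Proof. by rewrite addr_ge0 ?dotp_ge0 ?frob_ge0. Qed.

Lemma H1_density_comb_le (c : R) (u v : field) x :
  H1_density (c *: u + v) x <= 2 * c ^+ 2 * H1_density u x + 2 * H1_density v x.
Proof.
have := dotp_comb_le c (u.1 x) (v.1 x); have := frob_comb_le c (u.2 x) (v.2 x).
by rewrite /H1_density /=; lra.
Qed.

Lemma measurable_dotp dd (T : measurableType dd) (D : set T) (w : T -> E) :
  (forall i, measurable_fun D (fun x => w x ord0 i)) ->
  measurable_fun D (fun x => dotp (w x) (w x)).
Proof. by move=> mw; apply: measurable_sum => i; exact: measurable_funM. Qed.

Lemma measurable_frob dd (T : measurableType dd) (D : set T) (A B : T -> M) :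
  (forall i j, measurable_fun D (fun x => A x i j)) ->
  (forall i j, measurable_fun D (fun x => B x i j)) ->
  measurable_fun D (fun x => frob (A x) (B x)).
Proof.
move=> mA mB; apply: measurable_sum => i; apply: measurable_sum => j.
exact: measurable_funM.
Qed.

Lemma measurable_H1_density (D : set E) (v : field) :
  (forall i, measurable_fun D (fun x => v.1 x ord0 i)) ->
  (forall i j, measurable_fun D (fun x => v.2 x i j)) ->
  measurable_fun D (H1_density v).
Proof.
move=> m1 m2; apply: measurable_funD; first exact: measurable_dotp.
exact: measurable_frob.
Qed.

End density.

(** * Linearity of traces *)

Lemma cvg_integral_dotp_comb (dd : measure_display) (T : measurableType dd)
  (R : realType) (d : nat) (mu : {measure set T -> \bar R}) (D : set T) (c : R)
  (wu wv : T -> 'rV[R]_d) (phi psi : nat -> T -> 'rV[R]_d) :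
  measurable D ->
  (forall i, measurable_fun D (fun x => wu x ord0 i)) ->
  (forall i, measurable_fun D (fun x => wv x ord0 i)) ->
  (forall n i, measurable_fun D (fun x => phi n x ord0 i)) ->
  (forall n i, measurable_fun D (fun x => psi n x ord0 i)) ->
  (fun n => \int[mu]_(x in D) (dotp (phi n x - wu x) (phi n x - wu x))%:E)%E
    @ \oo --> 0%E ->
  (fun n => \int[mu]_(x in D) (dotp (psi n x - wv x) (psi n x - wv x))%:E)%E
    @ \oo --> 0%E ->
  (fun n => \int[mu]_(x in D)
    (dotp ((c *: phi n x + psi n x) - (c *: wu x + wv x))
          ((c *: phi n x + psi n x) - (c *: wu x + wv x)))%:E)%E @ \oo --> 0%E.
Proof.
move=> mD mwu mwv mphi mpsi.
have c0 : 0 <= 2 * c ^+ 2 by rewrite mulr_ge0// sqr_ge0.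
have mB (f w : T -> 'rV[R]_d) : (forall i, measurable_fun D (fun x => f x ord0 i)) ->
    (forall i, measurable_fun D (fun x => w x ord0 i)) ->
    forall i, measurable_fun D (fun x => (f x - w x) ord0 i).
  move=> mf mw i; have -> : (fun x => (f x - w x) ord0 i) =
      (fun x => f x ord0 i - w x ord0 i) by apply/funext => x; rewrite !mxE.
  exact: measurable_funB.
have E1 n x : (c *: phi n x + psi n x) - (c *: wu x + wv x) =
    c *: (phi n x - wu x) + (psi n x - wv x).
  by rewrite scalerBr opprD addrACA.
move=> cu cv; apply: (cvg_integral0_comb mD c0 _ _ _ _ _ _ _ cu cv).
- by move=> n; apply: measurable_dotp; exact: mB.
- by move=> n; apply: measurable_dotp; exact: mB.
- move=> n; apply: measurable_dotp => i.
  have -> : (fun x => ((c *: phi n x + psi n x) - (c *: wu x + wv x)) ord0 i) =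
      (fun x => c * (phi n x - wu x) ord0 i + (psi n x - wv x) ord0 i).
    by apply/funext => x; rewrite E1 !mxE.
  by apply: measurable_funD; [apply: measurable_funM => //|]; exact: mB.
- by move=> n x; exact: dotp_ge0.
- by move=> n x; exact: dotp_ge0.
- by move=> n x; exact: dotp_ge0.
- by move=> n x; rewrite E1; exact: dotp_comb_le.
Qed.

Section traces.
Context (R : realType) (d : nat).
Local Notation E := 'rV[R]_d.
Local Notation M := 'M[R]_d.
Local Notation field := ((E -> E) * (E -> M))%type.
Local Notation surface := (@hausdorff R d d.-1).
Local Notation S := (caratheodory_type surface).

(* The instances are named because the surface measure is the bare function
   underlying the outer measure, from which they cannot be inferred. *)
Let smeas : {measure set S -> \bar R} :=
  OuterMeasure_sort__canonical__measure_function_Measure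
    (Defs_hausdorff__canonical__measure_extension_OuterMeasure R d d.-1).

Lemma measurable_boundary (A : set E) : measurable (boundary A : set S).
Proof.
apply: hausdorff_borel; apply: measurableD.
  rewrite -[closure A]setCK; apply: measurableC; apply: open_rV_measurable.
  by rewrite openC; exact: closed_closure.
by apply: open_rV_measurable; exact: open_interior.
Qed.

Lemma surface_measureE : @surface_measure R d = smeas :> (set S -> \bar R).
Proof. by []. Qed.

(** A smooth function is continuous, hence Borel; the criterion for the
    Hausdorff measure makes it measurable for the surface measure, which the
    additivity of surface integrals requires. *)
Lemma smooth_measurable_surface (D : set S) (f : E -> R) : smooth f ->
  measurable_fun D (f : S -> R).
Proof.
move=> sf mD B mB; apply: measurableI => //; apply: hausdorff_borel.
by apply: continuous_rV_preimage => //; exact: smooth_continuous.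
Qed.

Definition field_measurable (Omega : set E) (v : field) :=
  (forall i, measurable_fun Omega (fun x => v.1 x ord0 i)) /\
  (forall i j, measurable_fun Omega (fun x => v.2 x i j)).

Lemma smooth_field_measurable (Omega : set E) (phi : E -> E) (v : field) :
  (forall i, smooth (fun x => phi x ord0 i)) -> field_measurable Omega v ->
  field_measurable Omega ((phi, jac phi) - v).
Proof.
move=> sphi [m1 m2]; split => [i|i j] /=.
  rewrite (_ : (fun _ => _) = (fun x => phi x ord0 i - v.1 x ord0 i)); last first.
    by apply/funext => x; rewrite !mxE.
  apply: measurable_funB => //; apply: continuous_rV_measurable_fun.
  exact: smooth_continuous.
rewrite (_ : (fun _ => _) = (fun x => pd j (fun y => phi y ord0 i) x - v.2 x i j));
  last by apply/funext => x; rewrite !mxE.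
apply: measurable_funB => //; apply: continuous_rV_measurable_fun.
exact: smooth_pd_continuous.
Qed.

Lemma field_measurable_comb (Omega : set E) (c : R) (u v : field) :
  field_measurable Omega u -> field_measurable Omega v ->
  field_measurable Omega (c *: u + v).
Proof.
move=> [u1 u2] [v1 v2]; split => [i|i j] /=.
  rewrite (_ : (fun _ => _) = (fun x => c * u.1 x ord0 i + v.1 x ord0 i)).
    by apply: measurable_funD => //; exact: measurable_funM.
  by apply/funext => x; rewrite !mxE.
rewrite (_ : (fun _ => _) = (fun x => c * u.2 x i j + v.2 x i j)).
  by apply: measurable_funD => //; exact: measurable_funM.
by apply/funext => x; rewrite !mxE.
Qed.

(** The same combination of the approximating smooth functions approximates
    both the field and its trace. *)
Lemma is_trace_comb (Omega : set E) (c : R) (u v : field) (wu wv : E -> E) :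
  measurable Omega -> field_measurable Omega u -> field_measurable Omega v ->
  is_trace Omega u wu -> is_trace Omega v wv ->
  is_trace Omega (c *: u + v) (c *: wu + wv).
Proof.
move=> mOmega mu mv [Lu [phi [sphi phiO phiG]]] [Lv [psi [spsi psiO psiG]]].
move: Lu Lv phiG psiG; rewrite !surface_measureE => Lu Lv phiG psiG.
have mG := measurable_boundary Omega.
have c0 : 0 <= 2 * c ^+ 2 by rewrite mulr_ge0// sqr_ge0.
rewrite /is_trace !surface_measureE; split.
  move=> i; rewrite (_ : (fun _ => _) =
      (fun x => c * wu x ord0 i + wv x ord0 i)); last first.
    by apply/funext => x; rewrite !mxE.
  exact: (in_L2D mG (in_L2Z mG c (Lu i)) (Lv i)).
exists (fun n => c *: phi n + psi n); split.
- move=> n i; rewrite (_ : (fun _ => _) =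
      (fun x => c * phi n x ord0 i + psi n x ord0 i)); last first.
    by apply/funext => x; rewrite !mxE.
  exact: smooth_comb.
- have E0 n : (c *: phi n + psi n, jac (c *: phi n + psi n)) - (c *: u + v) =
      c *: ((phi n, jac (phi n)) - u) + ((psi n, jac (psi n)) - v).
    rewrite jac_comb//; case: u {mu Lu phiO} => u1 u2; case: v {mv Lv psiO} => v1 v2.
    by congr pair; rewrite /= scalerBr opprD addrACA.
  apply: (cvg_integral0_comb mOmega c0 _ _ _ _ _ _ _ phiO psiO).
  + by move=> n; apply: measurable_H1_density; case: (smooth_field_measurable (sphi n) mu).
  + by move=> n; apply: measurable_H1_density; case: (smooth_field_measurable (spsi n) mv).
  + move=> n; rewrite E0; apply: measurable_H1_density;
    by case: (field_measurable_comb c (smooth_field_measurable (sphi n) mu)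
      (smooth_field_measurable (spsi n) mv)).
  + by move=> n x; exact: H1_density_ge0.
  + by move=> n x; exact: H1_density_ge0.
  + by move=> n x; exact: H1_density_ge0.
  + by move=> n x; rewrite E0; exact: H1_density_comb_le.
- apply: (@cvg_integral_dotp_comb _ S R d smeas _ c _ _ _ _ mG _ _ _ _ phiG psiG).
  + by move=> i; case: (Lu i).
  + by move=> i; case: (Lv i).
  + by move=> n i; exact: smooth_measurable_surface.
  + by move=> n i; exact: smooth_measurable_surface.
Qed.

End traces.

(** * Linearity of the space V and of the load *)

Lemma leb_bounded_lty (R : realType) (d : nat) (A : set 'rV[R]_d) :
  measurable A -> bounded_set A -> (leb R d A < +oo)%E.
Proof.
move=> mA [M [_ AM]]; pose r := `|M| + 1.
have r0 : 0 < r by rewrite ltr_wpDl.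
have [c c0 cE] := @leb_box R d 0 _ r0.
have mbox : measurable [set y : 'rV[R]_d | forall i, `|y ord0 i - (0 : 'rV[R]_d) ord0 i| <= r].
  apply: (@measurable_rV_cylinders R d (fun i => [set t | `|t - (0 : 'rV[R]_d) ord0 i| <= r])) => i.
  rewrite (_ : mkset _ = `[0 - r, 0 + r]%classic); first exact: measurable_itv.
  by apply/seteqP; split => t /=; rewrite in_itv /= mxE -ler_distl.
apply: (@le_lt_trans _ _ c%:E); last by rewrite ltry.
rewrite -cE; apply: le_measure; rewrite ?inE// => x Ax i.
rewrite mxE subr0; apply: le_trans (rV_coord_norm x i) _; apply: AM => //.
by rewrite /r (le_lt_trans (ler_norm M))// ltrDl.
Qed.

Lemma continuous_bounded_on (R : realType) (d : nat) (A : set 'rV[R]_d)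
  (f : 'rV[R]_d -> R) : bounded_set A -> continuous f ->
  exists c, forall x, A x -> `|f x| <= c.
Proof.
move=> [M [_ AM]] cf; pose r := `|M| + 1.
have cK : compact [set v : 'rV[R]_d | forall i, `[- r, r]%classic (v ord0 i)].
  by apply: (@rV_compact R d (fun=> `[- r, r]%classic)) => _; exact: segment_compact.
have cfK : {within [set v : 'rV[R]_d | forall i, `[- r, r]%classic (v ord0 i)], continuous f}.
  exact: continuous_subspaceT.
have [N [_ fN]] := compact_bounded (continuous_compact cfK cK).
exists (`|N| + 1) => x Ax; apply: fN; first by rewrite (le_lt_trans (ler_norm N))// ltrDl.
exists x => //= i; rewrite in_itv /= -ler_norml.
apply: le_trans (rV_coord_norm x i) _; apply: AM => //.
by rewrite /r (le_lt_trans (ler_norm M))// ltrDl.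
Qed.

Section linearity.
Context (R : realType) (d : nat).
Local Notation E := 'rV[R]_d.
Local Notation M := 'M[R]_d.
Local Notation field := ((E -> E) * (E -> M))%type.
Variables (Omega GammaD : set E).
Hypotheses (oOmega : open Omega) (bOmega : bounded_set Omega).
Local Notation surface := (@hausdorff R d d.-1).

Let mOmega : measurable Omega.
Proof. exact: open_rV_measurable. Qed.

Lemma continuous_in_L2 (f : E -> R) : continuous f -> in_L2 (leb R d) Omega f.
Proof.
move=> cf; have [c fc] := continuous_bounded_on bOmega cf.
apply: (in_L2_bounded mOmega _ _ fc); first exact: leb_bounded_lty.
exact: continuous_rV_measurable_fun.
Qed.

(** The pairings with a test function are integrable because test functions
    and their derivatives are bounded on the bounded set Omega. *)
Lemma H1_comb (c : R) (u v : field) :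
  H1 Omega u -> H1 Omega v -> H1 Omega (c *: u + v).
Proof.
move=> [u1 u2 u3] [v1 v2 v3].
have e1 i : (fun x => (c *: u + v).1 x ord0 i) =
    (fun x => c * u.1 x ord0 i + v.1 x ord0 i) by apply/funext => x; rewrite !mxE.
have e2 i j : (fun x => (c *: u + v).2 x i j) =
    (fun x => c * u.2 x i j + v.2 x i j) by apply/funext => x; rewrite !mxE.
split => [i|i j|phi tphi i j].
- by rewrite e1; apply: in_L2D => //; exact: in_L2Z.
- by rewrite e2; apply: in_L2D => //; exact: in_L2Z.
have sphi := tphi.1.
have L1 : in_L2 (leb R d) Omega (pd j phi).
  by apply: continuous_in_L2; exact: smooth_pd_continuous.
have L2 : in_L2 (leb R d) Omega phi.
  by apply: continuous_in_L2; exact: smooth_continuous.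
transitivity (\int[leb R d]_(x in Omega)
    ((c * u.1 x ord0 i + v.1 x ord0 i) * pd j phi x)).
  by apply: eq_Rintegral => x _; rewrite -[_ + v.1 x ord0 i]/((fun x => _) x) -e1.
rewrite Rintegral_L2_comb// u3// v3// mulrN -opprD; congr (- _).
rewrite -Rintegral_L2_comb//.
by apply: eq_Rintegral => x _; rewrite -[_ + v.2 x i j]/((fun x => _) x) -e2.
Qed.

Lemma H1_field_measurable (v : field) : H1 Omega v -> field_measurable Omega v.
Proof. by case=> v1 v2 _; split => [i|i j]; [case: (v1 i)|case: (v2 i j)]. Qed.

Lemma surface_null_comb (A B D : set E) : surface A = 0%E -> surface B = 0%E ->
  D `<=` A `|` B -> surface D = 0%E.
Proof.
move=> A0 B0 DAB; apply/eqP; rewrite eq_le outer_measure_ge0 andbT.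
apply: (le_trans (le_outer_measure surface _ _ DAB)).
apply: (le_trans (outer_measureU2 surface A B)).
by rewrite [X in (X + _)%E]A0 [X in (_ + X)%E]B0 adde0.
Qed.

Lemma V_comb (c : R) (u v : field) :
  V Omega GammaD u -> V Omega GammaD v -> V Omega GammaD (c *: u + v).
Proof.
move=> [Hu [wu [tu zu]]] [Hv [wv [tv zv]]]; split; first exact: H1_comb.
exists (c *: wu + wv); split.
  by apply: is_trace_comb => //; exact: H1_field_measurable.
apply: surface_null_comb zu zv _ => x [Gx wx].
have [u0|] := pselect (wu x = 0); last by left.
by right; split => // v0; apply: wx; change (c *: wu x + wv x = 0); rewrite u0 v0 scaler0 add0r.
Qed.

Lemma is_traceN_comb (c : R) (u v : field) (wu wv : E -> E) :
  H1 Omega u -> H1 Omega v ->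
  is_traceN Omega GammaD u wu -> is_traceN Omega GammaD v wv ->
  is_traceN Omega GammaD (c *: u + v) (c *: wu + wv).
Proof.
move=> Hu Hv [wu0 [tu zu]] [wv0 [tv zv]]; exists (c *: wu0 + wv0); split.
  by apply: is_trace_comb => //; exact: H1_field_measurable.
apply: surface_null_comb zu zv _ => x [Gx wx].
have [u0|] := pselect (wu x = wu0 x); last by left.
by right; split => // v0; apply: wx;
  change (c *: wu x + wv x = c *: wu0 x + wv0 x); rewrite u0 v0.
Qed.

Lemma traceN_correct (v : field) : V Omega GammaD v ->
  is_traceN Omega GammaD v (traceN Omega GammaD v).
Proof.
move=> [_ [w [tw _]]]; rewrite /traceN; apply: (@xgetPex _ 0).
exists w; exists w; split => //; rewrite (_ : mkset _ = set0) ?outer_measure0//.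
by apply/seteqP; split => x // [].
Qed.

(** The difference of two traces of v is a trace of 0, and g is bounded on it
    by a multiple of the H^1 norm of 0. *)
Lemma dual_traceN_unique (g : (E -> E) -> R) (v : field) (w1 w2 : E -> E) :
  in_tracesN_dual Omega GammaD g -> V Omega GammaD v ->
  is_traceN Omega GammaD v w1 -> is_traceN Omega GammaD v w2 -> g w1 = g w2.
Proof.
move=> [lg [c gc]] Vv t1 t2.
have v0 : (-1) *: v + v = 0 by rewrite scaleN1r addNr.
have Hv := Vv.1.
have /gc : V Omega GammaD ((-1) *: v + v) by exact: V_comb.
move=> /(_ _ (is_traceN_comb (-1) Hv Hv t2 t1)).
rewrite lg; [|by exists v|by exists v].
rewrite v0 (_ : H1_norm Omega 0 = 0) ?mulr0 ?normr_le0 ?mulN1r.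
  by rewrite addrC subr_eq0 => /eqP.
rewrite /H1_norm (_ : Rintegral _ _ _ = 0) ?sqrtr0//.
rewrite /Rintegral integral0_eq// => x _; congr _%:E.
rewrite /H1_density /dotp /frob big1 ?add0r => [|i _]; last by rewrite mxE mul0r.
by rewrite big1// => i _; rewrite big1// => j _; rewrite mxE mul0r.
Qed.

(** [traceN] picks an arbitrary trace, which need not be additive; the value
    of g does not depend on the choice. *)
Lemma load_comb (f : field -> R) (g : (E -> E) -> R) (c : R) (u v : field) :
  in_Vdual Omega GammaD f -> in_tracesN_dual Omega GammaD g ->
  V Omega GammaD u -> V Omega GammaD v ->
  load Omega GammaD f g (c *: u + v) =
  c * load Omega GammaD f g u + load Omega GammaD f g v.
Proof.
move=> [lf _] hg Vu Vv; have [lg _] := hg.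
have tu := traceN_correct Vu; have tv := traceN_correct Vv.
have Vuv := V_comb c Vu Vv.
have gE : g (traceN Omega GammaD (c *: u + v)) =
    c * g (traceN Omega GammaD u) + g (traceN Omega GammaD v).
  rewrite -lg; [|by exists u|by exists v].
  exact: (dual_traceN_unique hg Vuv (traceN_correct Vuv)
    (is_traceN_comb c Vu.1 Vv.1 tu tv)).
have fE := lf c u v Vu Vv.
rewrite /load.
rewrite [X in X + _ = _]fE.
rewrite [X in _ + X = _]gE.
by rewrite mulrDr addrACA.
Qed.

End linearity.

(** * Difference quotients of polynomial maps *)

Lemma continuous_sumr (R : realType) (T : topologicalType) (I : finType)
  (f : I -> T -> R) : (forall i, continuous (f i)) ->
  continuous (fun x => \sum_i f i x).
Proof.
move=> cf; rewrite (_ : (fun _ => _) = \big[(fun a b x => a x + b x)/(fun=> 0)]_i f i).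
  elim/big_rec : _ => [|i h _ ch]; first exact: cst_continuous.
  by move=> x; have cfx := cf i x; have chx := ch x; exact: cvgD cfx chx.
by apply/funext => x; elim/big_rec2 : _ => // i a h _ ->.
Qed.

Section slopes.
Context (R : realType) (d : nat).
Local Notation E := 'rV[R]_d.
Implicit Types f g : E -> R.

(** A continuous difference quotient in both variables (Hadamard). It yields
    the partial derivatives on the diagonal and strict differentiability near
    it, and it is stable under sums and products by algebra alone. *)
Definition has_slope f (q : 'I_d -> E * E -> R) :=
  [/\ continuous f, forall i, continuous (q i) &
      forall x y, f x - f y = \sum_i q i (x, y) * (x ord0 i - y ord0 i)].

Definition sloped f := exists q, has_slope f q.

Lemma continuous_coord i : continuous (fun x : E => x ord0 i).
Proof. by move=> x; exact: coord_continuous. Qed.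

Lemma sloped_cst c : sloped (fun=> c).
Proof.
exists (fun _ _ => 0); split; [exact: cst_continuous|move=> i; exact: cst_continuous|].
by move=> x y; rewrite subrr big1// => i _; rewrite mul0r.
Qed.

Lemma sloped_coord i : sloped (fun x => x ord0 i).
Proof.
exists (fun j _ => (j == i)%:R); split => [|j|x y]; first exact: continuous_coord.
  exact: cst_continuous.
rewrite (bigD1 i)//= eqxx mul1r big1 ?addr0// => j /negPf ->.
by rewrite mul0r.
Qed.

Lemma slopedD f g : sloped f -> sloped g -> sloped (fun x => f x + g x).
Proof.
move=> [p [cf cp fp]] [q [cg cq gq]]; exists (fun i z => p i z + q i z); split.
- by move=> x; have cfx := cf x; have cgx := cg x; exact: cvgD cfx cgx.
- by move=> i z; have cpz := cp i z; have cqz := cq i z; exact: cvgD cpz cqz.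
move=> x y; rewrite opprD addrACA fp gq -big_split; apply: eq_bigr => i _.
by rewrite mulrDl.
Qed.

Lemma slopedM f g : sloped f -> sloped g -> sloped (fun x => f x * g x).
Proof.
move=> [p [cf cp fp]] [q [cg cq gq]].
exists (fun i z => p i z * g z.1 + f z.2 * q i z); split.
- by move=> x; have cfx := cf x; have cgx := cg x; exact: cvgM cfx cgx.
- move=> i z; have cpz := cp i z; have cqz := cq i z.
  have c1 : (fun w : E * E => g w.1) @ z --> g z.1.
    by apply: continuous_comp; [exact: cvg_fst|exact: cg].
  have c2 : (fun w : E * E => f w.2) @ z --> f z.2.
    by apply: continuous_comp; [exact: cvg_snd|exact: cf].
  exact: cvgD (cvgM cpz c1) (cvgM c2 cqz).
move=> x y /=.
have -> : f x * g x - f y * g y = (f x - f y) * g x + f y * (g x - g y) by ring.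
rewrite fp gq mulr_suml mulr_sumr -big_split; apply: eq_bigr => i _ /=.
by ring.
Qed.

Lemma sloped_sum (I : finType) (f : I -> E -> R) : (forall i, sloped (f i)) ->
  sloped (fun x => \sum_i f i x).
Proof.
move=> sf; rewrite (_ : (fun _ => _) = \big[(fun a b x => a x + b x)/(fun=> 0)]_i f i).
  elim/big_rec : _ => [|i h _ sh]; first exact: sloped_cst.
  exact: slopedD.
by apply/funext => x; elim/big_rec2 : _ => // i a h _ ->.
Qed.

Lemma sloped_prod (I : finType) (f : I -> E -> R) : (forall i, sloped (f i)) ->
  sloped (fun x => \prod_i f i x).
Proof.
move=> sf; rewrite (_ : (fun _ => _) = \big[(fun a b x => a x * b x)/(fun=> 1)]_i f i).
  elim/big_rec : _ => [|i h _ sh]; first exact: sloped_cst.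
  exact: slopedM.
by apply/funext => x; elim/big_rec2 : _ => // i a h _ ->.
Qed.

Lemma slopedX f n : sloped f -> sloped (fun x => f x ^+ n).
Proof.
move=> sf; elim: n => [|n IH]; first by under eq_fun do rewrite expr0; exact: sloped_cst.
by under eq_fun do rewrite exprS; exact: slopedM.
Qed.

Lemma sloped_polyQ (n : nat) (c : {ffun 'I_d -> 'I_n.+1} -> R) :
  sloped (fun x => \sum_m c m * \prod_i x ord0 i ^+ m i).
Proof.
apply: sloped_sum => m; apply: slopedM; first exact: sloped_cst.
by apply: sloped_prod => i; apply: slopedX; exact: sloped_coord.
Qed.

Lemma has_slope_pd f q i x : has_slope f q -> pd i f x = q i (x, x).
Proof.
move=> [cf cq fq]; rewrite /pd /derive; apply: cvg_lim => //.
pose e : E := delta_mx ord0 i.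
have E0 (h : R) : h != 0 ->
    h^-1 *: ((f \o shift x) (h *: e) - f x) = q i (h *: e + x, x).
  move=> h0; rewrite /= fq (bigD1 i)//= big1 ?addr0 => [|j ji].
    by rewrite !mxE !eqxx mulr1 addrK [_ *: _]mulrC mulfK.
  by rewrite !mxE eqxx (negPf ji) mulr0 add0r subrr mulr0.
have cz : (fun h : R => q i (h *: e + x, x)) @ 0^' --> q i (x, x).
  have c1 : (fun h : R => h *: e + x) @ (0 : R)^' --> x.
    have c0 : (fun h : R => h) @ (0 : R)^' --> (0 : R) by exact: nbhs_dnbhs.
    have c3 := cvgD (cvgZ c0 (cvg_cst e)) (cvg_cst x).
    rewrite scale0r add0r in c3; exact: c3.
  have c2 : (fun h : R => x) @ (0 : R)^' --> x by exact: cvg_cst.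
  exact: (cvg_comp _ _ (cvg_pair c1 c2) (cq i (x, x))).
apply: cvg_trans cz; apply: near_eq_cvg; near=> h.
by rewrite /= E0//; near: h; exact: nbhs_dnbhs_neq.
Unshelve. all: by end_near. Qed.

Lemma mulmx_norm_le (m : R) (z : E) (N : 'M[R]_d) : 0 <= m ->
  (forall i j, `|N i j| <= m) -> `|z *m N| <= d%:R * m * `|z|.
Proof.
move=> m0 Nm; rewrite rV_normP ?mulr_ge0//; apply/forallP => j; rewrite mxE.
apply: (le_trans (ler_norm_sum _ _ _)).
apply: (@le_trans _ _ (\sum_(i < d) m * `|z|)).
  apply: ler_sum => i _; rewrite normrM mulrC ler_pM//; exact: rV_coord_norm.
by rewrite sumr_const card_ord -[leLHS]mulr_natl mulrA.
Qed.

End slopes.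

(** * Local openness of maps with invertible Jacobian *)

(* The Banach fixed point theorem needs row vectors to be at once complete and
   normed. *)
HB.instance Definition _ (R : realType) (n : nat) := Complete.on 'rV[R]_n.

(** Solve F x = y near x0 by the fixed point of
    T x = x - (F x - y) P, with P the inverse of the transposed Jacobian at x0
    (vectors are rows). The increments of T are those of x times the matrix
    N = 1 - Q P, where Q is the matrix of slopes; N is continuous and vanishes
    at (x0, x0), so T contracts a small ball. *)
Lemma sloped_locally_open (R : realType) (d : nat) (F : 'rV[R]_d -> 'rV[R]_d)
  (x0 : 'rV[R]_d) (B : set 'rV[R]_d) :
  (forall k, sloped (fun x => F x ord0 k)) ->
  jac F x0 \in unitmx -> nbhs x0 B -> nbhs (F x0) (F @` B).
Proof.
move=> /choice[q Fq] uJ xB.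
pose Q z := \matrix_(i < d, k < d) q k i z.
have FQ x y : F x - F y = (x - y) *m Q (x, y).
  apply/rowP => k; rewrite !mxE; case: (Fq k) => _ _ -> .
  by apply: eq_bigr => i _; rewrite !mxE mulrC.
have Q0 : Q (x0, x0) = (jac F x0)^T.
  by apply/matrixP => i k; rewrite !mxE (has_slope_pd i x0 (Fq k)).
pose P := invmx (jac F x0)^T.
have uJT : (jac F x0)^T \in unitmx by rewrite unitmx_tr.
pose N z := 1%:M - Q z *m P.
have cN i j : continuous (fun z => N z i j).
  have -> : (fun w => N w i j) =
      (fun w => (1%:M : 'M[R]_d) i j - \sum_k q k i w * P k j).
    by apply/funext => w; rewrite !mxE; congr (_ - _); apply: eq_bigr => k _; rewrite !mxE.
  have cs : continuous (fun w => \sum_k q k i w * P k j).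
    apply: continuous_sumr => k w; case: (Fq k) => _ /(_ i w) cq _.
    exact: cvgM cq (cvg_cst (P k j)).
  by move=> z; have csz := cs z; exact: cvgB (cvg_cst _) csz.
have N0 : N (x0, x0) = 0 by rewrite /N Q0 mulmxV// subrr.
(* with this bound on the entries of N, d * m <= 1/2 *)
pose m : R := (2 * d.+1%:R)^-1.
have m0 : 0 < m by rewrite invr_gt0 mulr_gt0.
have dm : d%:R * m <= 2^-1.
  rewrite /m invfM mulrCA ler_piMr ?invr_ge0// ler_pdivrMr// mul1r ler_nat.
  exact: leqnSn.
have near_N : nbhs (x0, x0) [set z | forall i j, `|N z i j| < m].
  have FF : Filter (nbhs (x0, x0)) by exact: nbhs_filter.
  refine (@filter_forall _ _ (fun (i : 'I_d) => [set z | forall j, `|N z i j| < m]) _ FF _) => i.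
  refine (@filter_forall _ _ (fun (j : 'I_d) => [set z | `|N z i j| < m]) _ FF _) => j.
  have cNx := cN i j (x0, x0).
  have /cNx : nbhs (N (x0, x0) i j) (ball (0 : R) m).
    by rewrite N0 mxE; exact: nbhsx_ballx.
  by refine (@filterS _ _ FF _ _ _) => z /=; rewrite -ball_normE /= sub0r normrN.
have [[A1 A2] /= [xA1 xA2] A12] := near_N.
have /nbhs_rV_box[e e0 eP] : nbhs x0 (A1 `&` A2 `&` B).
  by apply: filterI => //; exact: filterI.
pose U : set 'rV[R]_d := [set x | `|x - x0| <= e].
have UP x : U x -> (A1 `&` A2 `&` B) x.
  by move=> Ux; apply: eP => i; have := rV_coord_norm (x - x0) i; rewrite !mxE => /le_trans; apply.
have Nlip x y : U x -> U y -> `|(x - y) *m N (x, y)| <= 2^-1 * `|x - y|.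
  move=> /UP[[xA _] _] /UP[[_ yA] _].
  apply: le_trans (mulmx_norm_le _ (ltW m0) _) _.
    by move=> i j; apply: ltW; exact: (A12 (x, y)).
  by rewrite ler_wpM2r.
have U0 : U x0 by rewrite /U /= subrr normr0 ltW.
have cU : closed U.
  rewrite (_ : U = closed_ball_ (fun z => `|z|) x0 e); first exact: closed_closed_ball_.
  by apply/seteqP; split => z; rewrite /U /closed_ball_ /= distrC.
have [bP Pb] : exists2 b : R, 0 <= b & forall i j, `|P i j| <= b.
  exists `|P| => // i j; rewrite [leRHS]mx_normrE.
  exact: (le_bigmax _ (fun ij : 'I_d * 'I_d => `|P ij.1 ij.2|) (i, j)).
move=> PbP; apply/nbhs_rV_box; exists (e / 2 / (d%:R * bP + 1)).
  by rewrite !divr_gt0// ltr_wpDl// mulr_ge0.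
move=> y yF.
have yP : `|(F x0 - y) *m P| <= e / 2.
  apply: le_trans (mulmx_norm_le _ Pb PbP) _.
  have k0 : 0 < d%:R * bP + 1 by rewrite ltr_wpDl// mulr_ge0.
  apply: (@le_trans _ _ ((d%:R * bP + 1) * `|F x0 - y|)).
    by rewrite ler_wpM2r// lerDl.
  rewrite -ler_pdivlMl// mulrC rV_normP; last by rewrite !divr_ge0// ltW.
  by apply/forallP => i; rewrite !mxE distrC; exact: yF.
pose T x := x - (F x - y) *m P.
have TT x x' : T x - T x' = (x - x') *m N (x, x').
  rewrite /T /N mulmxBr mulmx1 mulmxA -FQ.
  have -> : F x - F x' = (F x - y) - (F x' - y) by rewrite opprB addrA subrK.
  rewrite [in RHS]mulmxBl; move: ((F x - y) *m P) ((F x' - y) *m P) => a b.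
  rewrite !opprB addrACA [RHS]addrACA; congr (_ + _).
  exact: addrC.
have TU : set_fun U U T.
  move=> x Ux; rewrite /U /=.
  have -> : T x - x0 = (T x - T x0) - (F x0 - y) *m P.
    by rewrite /T opprB addrA addrAC [RHS]addrAC subrK addrAC.
  apply: le_trans (ler_normB _ _) _; rewrite TT.
  have := Nlip _ _ Ux U0; have : `|x - x0| <= e by [].
  by move: yP; lra.
have ctr : is_contraction (mkfun TU).
  exists (2^-1)%:nng; split; first by rewrite /= invf_lt1// ltr1n.
  by move=> [x x'] [/= Ux Ux']; rewrite TT; exact: Nlip.
have [x Ux xT] := banach_fixed_point ctr cU (ex_intro _ x0 U0).
have {}xT : x = x - (F x - y) *m P := xT.
exists x; first by have [_] := UP _ Ux.
apply/eqP; rewrite -subr_eq0.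
have : (F x - y) *m P = 0.
  by apply/eqP; rewrite -oppr_eq0 -(inj_eq (addrI x)) addr0 -xT.
move=> /(congr1 (mulmxr (jac F x0)^T)) /=.
by rewrite -mulmxA mulVmx// mulmx1 mul0mx => ->.
Qed.

(** * Open elements *)

Section mesh.
Context (R : realType) (d : nat).
Local Notation E := 'rV[R]_d.
Local Notation M := 'M[R]_d.
Variables (kappa : R) (Omega : set E) (Th : finType).
Variables (F : Th -> E -> E) (p : Th -> nat).
Hypothesis oOmega : open Omega.
Hypothesis hmesh : hp_mesh kappa Omega F p.

Lemma nbhs_refcubeo (x : E) : refcubeo x -> nbhs x (@refcubeo R d).
Proof.
move=> xc.
have -> : @refcubeo R d = [set y | forall i, `]-1, 1[%classic (y ord0 i)].
  by apply/seteqP; split => y yc i; have := yc i; rewrite /= in_itv.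
refine (@filter_forall _ _ (fun (i : 'I_d) => [set y : E | `]-1, 1[%classic (y ord0 i)])
  _ (nbhs_filter x) _) => i.
have ci := @continuous_coord R d i x.
have /ci : nbhs (x ord0 i) `]-1, 1[%classic.
  by apply: open_nbhs_nbhs; split; [exact: interval_open|rewrite /= in_itv /=; exact: xc].
by [].
Qed.

Lemma refcubeo_sub (x : E) : refcubeo x -> refcube x.
Proof. by move=> xc i; have /andP[/ltW -> /ltW ->] := xc i. Qed.

(** The Jacobian of an element mapping is invertible on the reference cube by
    shape regularity. *)
Lemma element_map_open (T : Th) (x : E) (B : set E) :
  refcubeo x -> nbhs x B -> nbhs (F T x) (F T @` B).
Proof.
move=> xc xB; apply: sloped_locally_open xB.
  move=> k; have [c cF] := mesh_Q1 hmesh T k.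
  rewrite (_ : (fun _ => _) = (fun x : E => \sum_m c m * \prod_i x ord0 i ^+ m i)).
    exact: sloped_polyQ.
  by apply/funext => y; exact: cF.
by have [] := mesh_shape hmesh T (refcubeo_sub xc).
Qed.

Definition mesh_interior : set E := \bigcup_(T in [set: Th]) F T @` @refcubeo R d.

Lemma open_mesh_interior : open mesh_interior.
Proof.
rewrite openE => _ [T _ [x xc <-]]; rewrite /interior.
apply: filterS (element_map_open T xc (nbhs_refcubeo xc)) => y [z zc <-].
by exists T => //; exists z.
Qed.

Lemma leb_open_gt0 (A : set E) : open A -> A !=set0 -> (0 < leb R d A)%E.
Proof.
move=> oA [x Ax].
have /nbhs_rV_box[e e0 eA] : nbhs x A by exact: open_nbhs_nbhs.
have [c c0 cE] := leb_box x e0.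
apply: (@lt_le_trans _ _ c%:E); first by rewrite lte_fin.
rewrite -cE; apply: le_measure; rewrite ?inE//; last exact: open_rV_measurable.
apply: (@measurable_rV_cylinders R d (fun i => [set t | `|t - x ord0 i| <= e])) => i.
rewrite (_ : mkset _ = `[x ord0 i - e, x ord0 i + e]%classic); first exact: measurable_itv.
by apply/seteqP; split => t /=; rewrite in_itv /= ler_distl.
Qed.

(** A polynomial that vanishes almost everywhere in an element vanishes
    identically: otherwise it is nonzero on a set containing a nonempty open
    subset of Omega. This is what makes point evaluation at a quadrature node
    a well defined functional of an L^2 class. *)
Lemma polyQ_ae0 (T : Th) (n : nat) (f : E -> R) :
  polyQ n (@refcubeo R d) (fun x => f (F T x)) ->
  {ae leb R d, forall x, Omega x -> f x = 0} ->
  forall x, refcubeo x -> f (F T x) = 0.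
Proof.
move=> [c cf] [N [mN N0 fN]] x xc; apply: contrapT => fx0.
pose P (y : E) := \sum_m c m * \prod_i y ord0 i ^+ m i.
have cP : continuous P by have [q []] := sloped_polyQ c.
have xP : nbhs x (@refcubeo R d `&` [set y | P y != 0]).
  apply: (@filterI _ _ (nbhs_filter x)); first exact: nbhs_refcubeo.
  have cPx := cP x; have /cPx : nbhs (P x) [set~ 0].
    apply: open_nbhs_nbhs; split; last by move=> Px0; apply: fx0; rewrite cf.
    by rewrite openC; exact: closed_eq.
  by refine (@filterS _ _ (nbhs_filter x) _ _ _) => y /= Py; apply/eqP.
have oI := open_interior (F T @` (@refcubeo R d `&` [set y | P y != 0])).
have IF : (F T @` (@refcubeo R d `&` [set y | P y != 0]))° (F T x).
  exact: element_map_open.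
have clF : closure Omega (F T x).
  by rewrite (mesh_cover hmesh); exists T => //; exists x => //; exact: refcubeo_sub.
have [y [Oy Iy]] := clF _ (open_nbhs_nbhs (conj oI IF)).
pose A := Omega `&` (F T @` (@refcubeo R d `&` [set y | P y != 0]))°.
have oA : open A by exact: openI.
have A0 : (0 < leb R d A)%E by apply: leb_open_gt0 => //; exists y.
have : (leb R d A <= leb R d N)%E.
  apply: le_measure; rewrite ?inE//; first exact: open_rV_measurable.
  move=> z [Oz /interior_subset[w [wc /eqP Pw] wz]]; apply: fN => /= H.
  by apply: Pw; have := H Oz; rewrite -wz cf.
by rewrite N0 leNgt A0.
Qed.

End mesh.

(** * Riesz representation for a semidefinite form *)

Section linear_sets.
Context (R : realType) (X : lmodType R) (S : set X).
Hypotheses (S0 : S 0) (SL : forall c u v, S u -> S v -> S (c *: u + v)).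

Lemma lset_sum (k : nat) (a : 'I_k -> R) (e : 'I_k -> X) :
  (forall i, S (e i)) -> S (\sum_i a i *: e i).
Proof. by move=> Se; elim/big_rec : _ => // i x _ Sx; exact: SL. Qed.

Lemma linear_on_sum (f : X -> R) (k : nat) (a : 'I_k -> R) (e : 'I_k -> X) :
  linear_on S f -> (forall i, S (e i)) ->
  f (\sum_i a i *: e i) = \sum_i a i * f (e i).
Proof.
move=> lf Se; suff [] : S (\sum_i a i *: e i) /\
  f (\sum_i a i *: e i) = \sum_i a i * f (e i) by [].
elim/big_rec2 : _ => [|i y x _ [Sx fx]]; last first.
  by split; [exact: SL|rewrite lf// fx].
split => //; have := lf 1 0 0 S0 S0; rewrite scaler0 addr0 mul1r => H.
by apply: (addrI (f 0)); rewrite addr0 -H.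
Qed.

Variables (B : X -> X -> R) (G : X -> R).
Hypotheses (BL : forall w, S w -> linear_on S (B ^~ w))
  (BC : forall u v, S u -> S v -> B u v = B v u) (GL : linear_on S G)
  (G0 : forall u, S u -> B u u = 0 -> G u = 0).

(** The form B may be degenerate, so the Gram matrix A of the spanning family
    need not be invertible; but a vector c in its kernel has B-norm zero, hence
    is killed by G, and this says that the row of the G (e i) lies in the row
    space of A. *)
Lemma riesz_span (k : nat) (e : 'I_k -> X) : (forall i, S (e i)) ->
  (forall u, S u -> exists a : 'I_k -> R, u = \sum_i a i *: e i) ->
  exists2 m, S m & forall u, S u -> B m u = G u.
Proof.
move=> Se span.
pose A := \matrix_(i < k, j < k) B (e i) (e j).
pose g := \row_(i < k) G (e i).
have BR u : S u -> linear_on S (B u).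
  by move=> Su c v w Sv Sw; rewrite BC// ?BL//; [rewrite !(BC Su)|exact: SL].
have : (g <= A)%MS.
  rewrite submxE; apply/eqP/rowP => j; rewrite !mxE.
  pose c i := cokermx A i j; pose s := \sum_i c i *: e i.
  have Ss : S s by exact: lset_sum.
  have Bes i : B (e i) s = 0.
    have := congr1 (fun N : 'M[R]_k => N i j) (mulmx_coker A); rewrite !mxE => AK.
    rewrite (linear_on_sum _ (BR _ (Se i)))// -[RHS]AK.
    by apply: eq_bigr => l _; rewrite mxE mulrC.
  have : G s = 0.
    apply: G0 => //; rewrite (linear_on_sum _ (BL Ss))// big1// => i _.
    by rewrite Bes mulr0.
  rewrite (linear_on_sum _ GL Se) => Gs; rewrite -[RHS]Gs.
  by apply: eq_bigr => i _; rewrite mxE mulrC.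
move=> /submxP[D gD]; exists (\sum_i D ord0 i *: e i); first exact: lset_sum.
set m := \sum_i _; have Sm : S m by exact: lset_sum.
have mE i : B m (e i) = G (e i).
  have := congr1 (fun N : 'rV[R]_k => N ord0 i) gD; rewrite !mxE => ->.
  rewrite (linear_on_sum _ (BL (Se i)))//.
  by apply: eq_bigr => l _; rewrite mxE.
move=> u /span[a ->]; rewrite (linear_on_sum _ (BR _ Sm) Se) (linear_on_sum _ GL Se).
by apply: eq_bigr => i _; rewrite mE.
Qed.

End linear_sets.

(** Rel relates a vector to its possible coordinates in vT. Coordinates need
    not be unique, but they determine the vector; so vectors whose coordinates
    form a maximal free family span S. *)
Lemma finite_span (R : realType) (X : lmodType R) (S : set X) (vT : vectType R)
  (Rel : vT -> X -> Prop) : S 0 ->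
  (forall u, S u -> exists c, Rel c u) ->
  (forall a c u c' u', Rel c u -> Rel c' u' ->
     Rel (a *: c + c') (a *: u + u')) ->
  (forall c u u', Rel c u -> Rel c u' -> u = u') ->
  exists k (e : 'I_k -> X), (forall i, S (e i)) /\
    forall u, S u -> exists a : 'I_k -> R, u = \sum_i a i *: e i.
Proof.
move=> S0 tot lin func.
pose W c := exists2 u, S u & Rel c u.
pose P n := `[< exists2 s : n.-tuple vT, (forall i, W (tnth s i)) & free s >].
have exP : exists n, P n.
  by exists 0%N; apply/asboolP; exists [tuple] => [[]//|]; exact: nil_free.
have leP n : P n -> (n <= \dim (fullv : {vspace vT}))%N.
  move=> /asboolP[s _]; rewrite /free size_tuple => /eqP <-.
  by apply: dimvS; exact: subvf.
case: (ex_maxnP exP leP) => n /asboolP[s Ws fs] nmax.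
have /choice[e eP] i : exists u, S u /\ Rel (tnth s i) u.
  by have [u Su cu] := Ws i; exists u.
have Rel0 : Rel 0 0.
  by have [c c0] := tot 0 S0; have := lin (-1) _ _ _ _ c0 c0; rewrite scaler0 addr0 scaleN1r addNr.
exists n, e; split => [i|u Su]; first by have [] := eP i.
have [c cu] := tot u Su.
have cs : c \in span s.
  apply: contrapT => /negP cs; have : P n.+1; last by move=> /nmax; rewrite ltnn.
  apply/asboolP; exists (cons_tuple c s) => /=; last by rewrite free_cons cs.
  by move=> i; case: (unliftP ord0 i) => [j|] ->; rewrite ?tnthS ?tnth0//; exists u.
exists (fun i => coord s i c); apply: (func c) => //.
rewrite {1}(coord_span cs).
elim/big_rec2 : _ => // i x y _ IH.
by apply: lin => //; rewrite -tnth_nth; have [] := eP i.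
Qed.

(** * The Frobenius product and the L^2 product of matrix fields *)

Section frobenius.
Context (R : realType) (d : nat).
Local Notation M := 'M[R]_d.
Implicit Types A B X : M.

Lemma frobC A B : frob A B = frob B A.
Proof. by apply: eq_bigr => i _; apply: eq_bigr => j _; rewrite mulrC. Qed.

Lemma frobDl A B X : frob (A + B) X = frob A X + frob B X.
Proof.
rewrite -big_split; apply: eq_bigr => i _; rewrite -big_split.
by apply: eq_bigr => j _; rewrite mxE mulrDl.
Qed.

Lemma frobZl c A X : frob (c *: A) X = c * frob A X.
Proof.
rewrite mulr_sumr; apply: eq_bigr => i _; rewrite mulr_sumr.
by apply: eq_bigr => j _; rewrite mxE mulrA.
Qed.

Lemma frobDr A B X : frob X (A + B) = frob X A + frob X B.
Proof. by rewrite frobC frobDl !(frobC X). Qed.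

Lemma frobZr c A X : frob X (c *: A) = c * frob X A.
Proof. by rewrite frobC frobZl (frobC X). Qed.

Lemma frobNl A X : frob (- A) X = - frob A X.
Proof. by rewrite -scaleN1r frobZl mulN1r. Qed.

Lemma frobNr A X : frob X (- A) = - frob X A.
Proof. by rewrite frobC frobNl (frobC X). Qed.

Lemma frob0l X : frob 0 X = 0.
Proof. by rewrite -(scale0r 0) frobZl mul0r. Qed.

Lemma frob_eq0 A : frob A A = 0 -> A = 0.
Proof.
move=> /eqP; rewrite psumr_eq0 => [/allP H|i _]; last first.
  by apply: sumr_ge0 => j _; rewrite -expr2 sqr_ge0.
apply/matrixP => i j; have := H i (mem_index_enum _); rewrite /= psumr_eq0.
  by move=> /allP/(_ j (mem_index_enum _)); rewrite /= mulf_eq0 orbb mxE => /eqP.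
by move=> k _; rewrite -expr2 sqr_ge0.
Qed.

Lemma frob_trmx A X : X^T = X -> frob A^T X = frob A X.
Proof.
move=> XT; rewrite /frob exchange_big; apply: eq_bigr => i _.
by apply: eq_bigr => j _; rewrite mxE -{1}XT mxE.
Qed.

Lemma frob_scalar c X : frob c%:M X = c * \tr X.
Proof.
rewrite mulr_sumr; apply: eq_bigr => i _; rewrite (bigD1 i)//= mxE eqxx mulr1n.
by rewrite big1 ?addr0// => j ji; rewrite mxE eq_sym (negPf ji) mul0r.
Qed.

Lemma frob_dev A X : \tr X = 0 -> frob (dev A) X = frob A X.
Proof. by move=> X0; rewrite /dev frobDl frobNl frob_scalar X0 mulr0 subr0. Qed.

Lemma fnorm_ge0 A : 0 <= fnorm A. Proof. exact: sqrtr_ge0. Qed.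

Lemma fnorm_sqr A : fnorm A ^+ 2 = frob A A.
Proof. by rewrite sqr_sqrtr// frob_ge0. Qed.

Lemma fnormZ c A : fnorm (c *: A) = `|c| * fnorm A.
Proof.
rewrite /fnorm frobZl frobZr mulrA -expr2 sqrtrM ?sqr_ge0//.
by rewrite sqrtr_sqr.
Qed.

Lemma fnorm_eq0 A : fnorm A = 0 -> A = 0.
Proof. by move=> A0; apply: frob_eq0; rewrite -fnorm_sqr A0 expr0n. Qed.

(** Cauchy-Schwarz, from the nonnegativity of the square norm of
    |B|^2 A - (A : B) B. *)
Lemma frob_le A B : frob A B <= fnorm A * fnorm B.
Proof.
have [B0|B0] := eqVneq (fnorm B) 0.
  by rewrite (fnorm_eq0 B0) frobC frob0l mulr_ge0// fnorm_ge0.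
have b0 : 0 < fnorm B by rewrite lt_def B0 fnorm_ge0.
have := frob_ge0 (fnorm B ^+ 2 *: A - frob A B *: B).
rewrite frobDl frobNl !frobZl !frobDr !frobNr !frobZr -!fnorm_sqr (frobC B A).
set c := frob A B; set a := fnorm A; set b := fnorm B => H.
have a0 : 0 <= a by exact: fnorm_ge0.
have {}H : 0 <= b ^+ 2 * ((a * b) ^+ 2 - c ^+ 2) by move: H; lra.
move: H; rewrite pmulr_rge0 ?exprn_gt0// subr_ge0 => H.
have ab0 : 0 <= a * b by rewrite mulr_ge0// ltW.
have [c0|c0] := leP c 0; first exact: le_trans ab0.
by rewrite -(@ler_pXn2r _ 2)// nnegrE// ltW.
Qed.

(** The inverse of 0 is 0, so the direction of the zero matrix is 0. *)
Definition direction A : M := (fnorm A)^-1 *: A.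

Lemma frob_direction_le A X : frob (direction A) X <= fnorm X.
Proof.
apply: le_trans (frob_le _ _) _; rewrite fnormZ.
have [->|A0] := eqVneq (fnorm A) 0; first by rewrite mulr0 mul0r fnorm_ge0.
by rewrite ger0_norm ?invr_ge0 ?fnorm_ge0// mulVf// mul1r.
Qed.

Lemma frob_direction A : frob (direction A) A = fnorm A.
Proof.
rewrite frobZl -fnorm_sqr; have [->|A0] := eqVneq (fnorm A) 0.
  by rewrite expr0n mulr0.
by rewrite expr2 mulrA mulVf// mul1r.
Qed.

(** The orthogonal projection of a matrix onto the symmetric trace-free ones. *)
Definition symdev A : M := dev (2^-1 *: (A + A^T)).

Lemma frob_symdev A X : sym0 X -> frob (symdev A) X = frob A X.
Proof.
move=> [XT X0]; rewrite frob_dev// frobZl frobDl frob_trmx//.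
by lra.
Qed.

Lemma sym0_symdev A : (0 < d)%N -> sym0 (symdev A).
Proof.
move=> d0; split.
  rewrite /symdev /dev linearB /= tr_scalar_mx linearZ /= linearD /= trmxK.
  by rewrite (addrC A).
rewrite /symdev /dev linearB /= mxtrace_scalar -[X in _ - X]mulr_natr divfK ?subrr//.
by rewrite pnatr_eq0 -lt0n.
Qed.

Lemma sym0_comb c A B : sym0 A -> sym0 B -> sym0 (c *: A + B).
Proof.
move=> [AT A0] [BT B0]; split; first by rewrite linearP /= AT BT.
by rewrite linearP /= A0 B0 mulr0 addr0.
Qed.

Lemma sym0_0 : sym0 (0 : M).
Proof. by split; [rewrite trmx0|rewrite mxtrace0]. Qed.

End frobenius.

Lemma integrable_sumr (dd : measure_display) (T : measurableType dd)
  (R : realType) (mu : {measure set T -> \bar R}) (D : set T) (I : finType)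
  (f : I -> T -> R) : measurable D ->
  (forall i, mu.-integrable D (EFin \o f i)) ->
  mu.-integrable D (EFin \o (fun x => \sum_i f i x)).
Proof.
move=> mD fI; rewrite (_ : (fun _ => _) = \big[(fun a b x => a x + b x)/(fun=> 0)]_i f i).
  elim/big_rec : _ => [|i h _ hI]; first exact: integrable0.
  exact: (integrableD mD (fI i) hI).
by apply/funext => x; elim/big_rec2 : _ => // i a h _ ->.
Qed.

Section inner_product.
Context (R : realType) (d : nat).
Local Notation E := 'rV[R]_d.
Local Notation M := 'M[R]_d.
Variable Omega : set E.
Hypothesis oOmega : open Omega.
Implicit Types A B X : E -> M.

Let mOmega : measurable Omega.
Proof. exact: open_rV_measurable. Qed.

Definition L2mx A := forall i j, in_L2 (leb R d) Omega (fun x => A x i j).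

Lemma L2mx_comb c A B : L2mx A -> L2mx B -> L2mx (c *: A + B).
Proof.
move=> LA LB i j; have -> : (fun x => (c *: A + B) x i j) =
    (fun x => c * A x i j + B x i j) by apply/funext => x; rewrite !mxE.
by apply: in_L2D => //; exact: in_L2Z.
Qed.

Lemma L2mx0 : L2mx 0.
Proof.
move=> i j; rewrite (_ : (fun _ => _) = (fun=> 0)); first exact: in_L2_0.
by apply/funext => x; rewrite mxE.
Qed.

Lemma integrable_frob A B : L2mx A -> L2mx B ->
  (leb R d).-integrable Omega (EFin \o (fun x => frob (A x) (B x))).
Proof.
move=> LA LB; apply: integrable_sumr => // i; apply: integrable_sumr => // j.
exact: in_L2_integrableM.
Qed.

Lemma ipC A B : ip Omega A B = ip Omega B A.
Proof. by apply: eq_Rintegral => x _; rewrite frobC. Qed.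

Lemma ip_linear X : L2mx X -> linear_on L2mx ((ip Omega)^~ X).
Proof.
move=> LX c A B LA LB; rewrite /ip.
have IA := integrable_frob LA LX; have IB := integrable_frob LB LX.
rewrite -RintegralZl// -RintegralD//; last exact: (integrableZl mOmega c IA).
by apply: eq_Rintegral => x _; rewrite -frobZl -frobDl.
Qed.

Lemma ip_linearr X : L2mx X -> linear_on L2mx (ip Omega X).
Proof.
by move=> LX c A B LA LB; rewrite ipC (ip_linear LX c LA LB) !(ipC X).
Qed.

Lemma ip_ae_eq A B A' B' : L2mx A -> L2mx B -> L2mx A' -> L2mx B' ->
  {ae leb R d, forall x, Omega x -> frob (A x) (B x) = frob (A' x) (B' x)} ->
  ip Omega A B = ip Omega A' B'.
Proof.
move=> LA LB LA' LB' AB; congr fine.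
have /measurable_int m1 := integrable_frob LA LB.
have /measurable_int m2 := integrable_frob LA' LB'.
apply: (ae_eq_integral (EFin \o (fun x => frob (A' x) (B' x)))) => //.
by apply: filterS AB => x H Ox /=; rewrite H.
Qed.

Lemma ip_null A X : L2mx A -> L2mx X ->
  {ae leb R d, forall x, Omega x -> X x = 0} -> ip Omega A X = 0.
Proof.
move=> LA LX X0; rewrite (@ip_ae_eq A X 0 0)//; [|exact: L2mx0|exact: L2mx0|].
  by rewrite /ip /Rintegral integral0_eq// => x _; rewrite frob0l.
by apply: filterS X0 => x H Ox; rewrite H// frobC !frob0l.
Qed.

Lemma ip_definite A : L2mx A -> ip Omega A A = 0 ->
  {ae leb R d, forall x, Omega x -> A x = 0}.
Proof.
move=> LA A0; have IA := integrable_frob LA LA.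
have /measurable_int mA := IA.
have A0' : (\int[leb R d]_(x in Omega) (frob (A x) (A x))%:E)%E = 0%E.
  by rewrite -[LHS]fineK ?(integrable_fin_num mOmega IA)//; congr _%:E.
have : ae_eq (leb R d) Omega (EFin \o (fun x => frob (A x) (A x))) (cst 0%E).
  apply/ae_eq_integral_abs => //; rewrite -[RHS]A0'.
  by apply: eq_integral => x _; rewrite /= ger0_norm// frob_ge0.
by apply: filterS => x H Ox; apply: frob_eq0; have [] := H Ox.
Qed.

End inner_product.

(** * The finite element spaces and the projection *)

Section spaces.
Context (R : realType) (d : nat).
Local Notation E := 'rV[R]_d.
Local Notation M := 'M[R]_d.
Local Notation field := ((E -> E) * (E -> M))%type.
Variables (kappa : R) (Omega GammaD : set E) (Th : finType).
Variables (F : Th -> E -> E) (p : Th -> nat).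
Hypotheses (d_gt0 : (0 < d)%N) (oOmega : open Omega) (bOmega : bounded_set Omega).
Hypothesis hmesh : hp_mesh kappa Omega F p.

Let mOmega : measurable Omega.
Proof. exact: open_rV_measurable. Qed.

Lemma polyQ_comb (n : nat) (D : set E) (c : R) (f g : E -> R) :
  polyQ n D f -> polyQ n D g -> polyQ n D (fun x => c * f x + g x).
Proof.
move=> [a fa] [b gb]; exists (fun m => c * a m + b m) => x Dx.
rewrite fa// gb// mulr_sumr -big_split; apply: eq_bigr => m _ /=.
by rewrite mulrDl mulrA.
Qed.

Lemma polyQ_eq (n : nat) (D : set E) (f g : E -> R) :
  (forall x, D x -> f x = g x) -> polyQ n D f -> polyQ n D g.
Proof. by move=> fg [a fa]; exists a => x Dx; rewrite -fg// fa. Qed.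

Lemma Vhp_comb (c : R) (u v : field) : Vhp Omega GammaD F p u ->
  Vhp Omega GammaD F p v -> Vhp Omega GammaD F p (c *: u + v).
Proof.
move=> [Vu pu] [Vv pv]; split; first exact: V_comb.
move=> T i; apply: polyQ_eq (polyQ_comb c (pu T i) (pv T i)) => x _.
by rewrite !mxE.
Qed.

Lemma Q_L2mx (q : E -> M) : Q Omega q -> L2mx Omega q.
Proof. by case. Qed.

Lemma Q_comb (c : R) (q r : E -> M) : Q Omega q -> Q Omega r ->
  Q Omega (c *: q + r).
Proof.
move=> [Lq sq] [Lr sr]; split; first exact: L2mx_comb.
by apply: filterS2 sq sr => x qx rx Ox; apply: sym0_comb; [exact: qx|exact: rx].
Qed.

Lemma Q0 : Q Omega 0.
Proof.
split; first exact: L2mx0.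
by apply: aeW => x _; exact: sym0_0.
Qed.

Lemma Qhp_comb (c : R) (q r : E -> M) : Qhp Omega F p q ->
  Qhp Omega F p r -> Qhp Omega F p (c *: q + r).
Proof.
move=> [Qq pq] [Qr pr]; split; first exact: Q_comb.
move=> T i j; apply: polyQ_eq (polyQ_comb c (pq T i j) (pr T i j)) => x _.
by rewrite !mxE.
Qed.

Lemma Qhp0 : Qhp Omega F p 0.
Proof.
split; first exact: Q0.
by move=> T i j; exists (fun=> 0) => x _; rewrite mxE big1// => m _; rewrite mul0r.
Qed.

Local Notation U := (mesh_interior F).

(** Written with indicators so that measurability and square integrability
    follow from those of products and sums. *)
Definition glue (q r : E -> M) : E -> M :=
  fun x => (\1_U x : R) *: q x + (1 - \1_U x : R) *: r x.

Lemma glueT (q r : E -> M) x : U x -> glue q r x = q x.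
Proof.
by move=> Ux; rewrite /glue indicE mem_set// subrr scale0r addr0 scale1r.
Qed.

Lemma glueF (q r : E -> M) x : ~ U x -> glue q r x = r x.
Proof.
by move=> Ux; rewrite /glue indicE memNset// subr0 scale0r add0r scale1r.
Qed.

Lemma L2mx_glue (q r : E -> M) : L2mx Omega q -> L2mx Omega r ->
  L2mx Omega (glue q r).
Proof.
move=> Lq Lr i j; have mU : measurable U.
  by apply: open_rV_measurable; exact: open_mesh_interior hmesh.
have -> : (fun x => glue q r x i j) =
    (fun x => \1_U x * q x i j + (1 - \1_U x) * r x i j).
  by apply/funext => x; rewrite !mxE.
have m1 : measurable_fun Omega (\1_U : E -> R) by exact: measurable_indic.
apply: in_L2D => //; apply: (@in_L2M_bounded _ _ _ _ _ mOmega 1) => //.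
- apply: aeW => x _; rewrite indicE; case: (x \in U); rewrite ?normr1 ?normr0//.
- by apply: measurable_funB => //; exact: measurable_cst.
- by apply: aeW => x _; rewrite indicE; case: (x \in U); rewrite ?subrr ?subr0 ?normr1 ?normr0.
Qed.

Lemma Qhp_glue (q r : E -> M) : Qhp Omega F p q -> Q Omega r ->
  Qhp Omega F p (glue q r).
Proof.
move=> [[Lq sq] pq] [Lr sr]; split; first split.
- exact: L2mx_glue.
- apply: filterS2 sq sr => x qx rx Ox.
  have [Ux|Ux] := pselect (U x); first by rewrite glueT//; exact: qx.
  by rewrite glueF//; exact: rx.
- move=> T i j; apply: polyQ_eq (pq T i j) => x xc.
  by rewrite glueT//; exists T => //; exists x.
Qed.

Lemma glue_linear (c : R) (q r : E -> M) :
  glue (c *: q + r) 0 = c *: glue q 0 + glue r 0.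
Proof.
apply/funext => x; change (glue (c *: q + r) 0 x = c *: glue q 0 x + glue r 0 x).
have [Ux|Ux] := pselect (U x); first by rewrite !glueT.
by rewrite !glueF// scaler0 addr0.
Qed.

Lemma Qhp_L2mx (q : E -> M) : Qhp Omega F p q -> L2mx Omega q.
Proof. by move=> [[]]. Qed.

Let J (T : Th) := ('I_d * 'I_d * {ffun 'I_d -> 'I_(p T).-1.+1})%type.
Let I := {T : Th & J T}.

Let coef (c : {ffun I -> R^o}) (q : E -> M) :=
  (forall T x i j, refcubeo x -> q (F T x) i j =
    \sum_m (c (@Tagged Th T J (i, j, m)) : R) * \prod_k x ord0 k ^+ m k) /\
  forall x, ~ U x -> q x = 0.

(** Elements vanishing off the open elements form a genuinely finite
    dimensional space of functions: they are determined by the coefficients of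
    the pulled-back polynomials. Without this normalization the values on the
    mesh skeleton are arbitrary. *)
Lemma Qhp_finite_span :
  let S := [set q | Qhp Omega F p q /\ forall x, ~ U x -> q x = 0] in
  exists k (e : 'I_k -> E -> M), (forall i, S (e i)) /\
  forall q, S q -> exists a : 'I_k -> R, q = \sum_i a i *: e i.
Proof.
apply: (@finite_span R (E -> M) _ _ coef).
- by split; [exact: Qhp0|].
- move=> q [[_ pq] q0]; pose c T i j := projT1 (cid (pq T i j)).
  exists [ffun t : I => c (tag t) (tagged t).1.1 (tagged t).1.2 (tagged t).2].
  split => // T x i j xc; rewrite (projT2 (cid (pq T i j)) x xc).
  by apply: eq_bigr => m _; rewrite ffunE.
- move=> a c q c' q' [cq q0] [cq' q0']; split => [T x i j xc|x Ux].
    change ((a *: q (F T x) + q' (F T x)) i j = \sum_m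
      (a *: c + c') (@Tagged Th T J (i, j, m)) * \prod_k x ord0 k ^+ m k).
    rewrite 2!mxE cq// cq'// mulr_sumr -big_split; apply: eq_bigr => m _.
    by rewrite !ffunE mulrDl mulrA.
  by change (a *: q x + q' x = 0); rewrite q0// q0'// scaler0 addr0.
- move=> c q q' [cq q0] [cq' q0']; apply/funext => x.
  have [[T _ [y yc <-]]|Ux] := pselect (U x); last by rewrite q0// q0'.
  by apply/matrixP => i j; rewrite cq// cq'.
Qed.

(** Replacing q by glue q 0 reduces to the members of Qhp that vanish off the
    open elements; they have a finite spanning family. *)
Lemma Qhp_riesz (G : (E -> M) -> R) : linear_on (Qhp Omega F p) G ->
  (forall q, Qhp Omega F p q -> G (glue q 0) = G q) ->
  (forall q, Qhp Omega F p q ->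
    {ae leb R d, forall x, Omega x -> q x = 0} -> G q = 0) ->
  exists2 m, Qhp Omega F p m & forall q, Qhp Omega F p q -> ip Omega m q = G q.
Proof.
move=> GL Gglue G0; have [k [e [Se span]]] := Qhp_finite_span.
set S := [set q | Qhp Omega F p q /\ _] in Se span.
have SQ q : S q -> Qhp Omega F p q by case.
have SL2 q : S q -> L2mx Omega q by move=> /SQ; exact: Qhp_L2mx.
have S0 : S 0 by split; [exact: Qhp0|].
have SL c u v : S u -> S v -> S (c *: u + v).
  move=> [Qu u0] [Qv v0]; split; first exact: Qhp_comb.
  by move=> x Ux; change (c *: u x + v x = 0); rewrite u0// v0// scaler0 addr0.
have Sglue q : Qhp Omega F p q -> S (glue q 0).
  move=> Qq; split; first by apply: Qhp_glue => //; exact: Q0.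
  by move=> x Ux; rewrite glueF.
have BL w : S w -> linear_on S ((ip Omega)^~ w).
  by move=> Sw c u v Su Sv; apply: (ip_linear oOmega (SL2 w Sw)); exact: SL2.
have GLS : linear_on S G by move=> c u v /SQ Qu /SQ Qv; exact: GL.
have GN u : S u -> ip Omega u u = 0 -> G u = 0.
  move=> Su uu; apply: G0; first exact: SQ.
  by apply: ip_definite => //; exact: SL2.
have [m Sm mG] := riesz_span S0 SL BL (fun u v _ _ => ipC Omega u v) GLS GN Se span.
exists m; first exact: SQ.
move=> q Qq; rewrite -Gglue// -mG; last exact: Sglue.
apply: eq_Rintegral => x _; have [Ux|Ux] := pselect (U x); first by rewrite glueT.
by rewrite (Sm.2 x Ux) !frob0l.
Qed.

Lemma L2mx_symdev (m : E -> M) : L2mx Omega m ->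
  L2mx Omega (fun x => symdev (m x)).
Proof.
move=> Lm; have Ls i j : in_L2 (leb R d) Omega
    (fun x => 2^-1 * m x i j + 2^-1 * m x j i).
  by apply: in_L2D => //; exact: in_L2Z.
move=> i j; rewrite (_ : (fun _ => _) = (fun x =>
    (2^-1 * m x i j + 2^-1 * m x j i) +
    (- (d%:R^-1 *+ (i == j))) * \sum_k (2^-1 * m x k k + 2^-1 * m x k k))).
  by apply: in_L2D => //; apply: in_L2Z => //; apply: in_L2_sum => // k; exact: Ls.
apply/funext => x; rewrite /symdev /dev !mxE mulrDr; congr (_ + _).
rewrite /mxtrace mulNr mulrnAl; congr (- (_ *+ _)); rewrite mulrC; congr (_ * _).
by apply: eq_bigr => k _; rewrite !mxE mulrDr.
Qed.

Lemma Q_symdev (m : E -> M) : L2mx Omega m -> Q Omega (fun x => symdev (m x)).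
Proof.
move=> Lm; split; first exact: L2mx_symdev.
by apply: aeW => x _; exact: sym0_symdev.
Qed.

(** On the open elements the projection is given by Riesz representation in a
    finite dimensional space; elsewhere members of Qhp are unconstrained apart
    from being symmetric and trace-free, so the pointwise projection is used. *)
Lemma Php_spec (m : E -> M) : L2mx Omega m ->
  Qhp Omega F p (Php Omega F p m) /\
  forall q, Qhp Omega F p q -> ip Omega (Php Omega F p m) q = ip Omega m q.
Proof.
move=> Lm; suff [l Ql lm] : exists2 l, Qhp Omega F p l &
    forall q, Qhp Omega F p q -> ip Omega l q = ip Omega m q.
  have sub l' q : Qhp Omega F p l' -> Qhp Omega F p q ->
      ip Omega (m - l') q = ip Omega m q - ip Omega l' q.
    move=> Ql' Qq; rewrite -[m - l']addrC -scaleN1r.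
    rewrite (ip_linear oOmega (Qhp_L2mx Qq))//; last exact: Qhp_L2mx.
    by rewrite mulN1r addrC.
  have : exists l, Qhp Omega F p l /\
      forall q, Qhp Omega F p q -> ip Omega (m - l) q = 0.
    by exists l; split => // q Qq; rewrite sub// lm// subrr.
  move=> /(@xgetPex _ 0)[QP P0]; split => // q Qq.
  by have := P0 q Qq; rewrite sub// => /eqP; rewrite subr_eq0 => /eqP.
have Lg (q : E -> M) : Qhp Omega F p q -> L2mx Omega (glue q 0).
  by move=> /Qhp_L2mx Lq; apply: L2mx_glue => //; exact: L2mx0.
have [||q Qq q0|m0 Qm0 m0E] := @Qhp_riesz (fun q => ip Omega m (glue q 0)).
- move=> c u v Qu Qv; rewrite glue_linear.
  by apply: (ip_linearr oOmega Lm); exact: Lg.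
- move=> q Qq; apply: eq_Rintegral => x _; congr frob.
  by have [Ux|Ux] := pselect (U x); [rewrite !glueT|rewrite !glueF].
- apply: ip_null => //; first exact: Lg.
  apply: filterS q0 => x q0 Ox; have [Ux|Ux] := pselect (U x).
    by rewrite glueT// q0.
  by rewrite glueF.
exists (glue m0 (fun x => symdev (m x))); first by apply: Qhp_glue => //; exact: Q_symdev.
move=> q Qq; have Lq := Qhp_L2mx Qq.
have Lgc : L2mx Omega (glue 0 q) by apply: L2mx_glue => //; exact: L2mx0.
have qE : q = 1 *: glue q 0 + glue 0 q.
  apply/funext => x; change (q x = 1 *: glue q 0 x + glue 0 q x); rewrite scale1r.
  by have [Ux|Ux] := pselect (U x); [rewrite !glueT// addr0|rewrite !glueF// add0r].
have Lgl : L2mx Omega (glue m0 (fun x => symdev (m x))).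
  by apply: L2mx_glue; [exact: Qhp_L2mx|exact: L2mx_symdev].
rewrite {1 2}qE (ip_linearr oOmega Lgl) ?(ip_linearr oOmega Lm)//; try exact: Lg.
have gg : glue (glue q 0) 0 = glue q 0.
  by apply/funext => x; have [Ux|Ux] := pselect (U x); [rewrite !glueT|rewrite !glueF].
have -> : ip Omega m (glue q 0) = ip Omega m0 (glue q 0).
  by rewrite m0E ?gg//; apply: Qhp_glue => //; exact: Q0.
congr (1 * _ + _).
- apply: eq_Rintegral => x _; have [Ux|Ux] := pselect (U x).
    by rewrite !glueT.
  by rewrite (glueF q 0)// frobC [RHS]frobC; exact: etrans (frob0l _) (esym (frob0l _)).
- apply: ip_ae_eq => //; have [[_ sq] _] := Qq.
  apply: filterS sq => x qx Ox; have [Ux|Ux] := pselect (U x).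
    by rewrite (glueT 0 q)// frobC [RHS]frobC; exact: etrans (frob0l _) (esym (frob0l _)).
  by rewrite !glueF// frob_symdev//; exact: qx.
Qed.

End spaces.

(** * Quadrature, the plasticity functional and the bilinear form *)

Section quadrature.
Context (R : realType) (d : nat).
Local Notation E := 'rV[R]_d.
Local Notation M := 'M[R]_d.
Variables (gx gw : forall n : nat, 'I_n -> R).
Hypothesis hgauss : forall n : nat, (0 < n)%N -> gauss_rule (@gx n) (@gw n).

Lemma quad_comb (F : E -> E) (n : nat) (c : R) (f g : E -> R) :
  quad (@gx) (@gw) F n (fun x => c * f x + g x) =
  c * quad (@gx) (@gw) F n f + quad (@gx) (@gw) F n g.
Proof.
rewrite /quad; case: ifP => _; first by ring.
by rewrite mulr_sumr -big_split; apply: eq_bigr => k _ /=; ring.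
Qed.

Lemma quadZ (F : E -> E) (n : nat) (c : R) (f : E -> R) :
  quad (@gx) (@gw) F n (fun x => c * f x) = c * quad (@gx) (@gw) F n f.
Proof.
rewrite /quad; case: ifP => _; first by ring.
by rewrite mulr_sumr; apply: eq_bigr => k _ /=; ring.
Qed.

Lemma quad_le (F : E -> E) (n : nat) (f g : E -> R) : (0 < n)%N ->
  (forall x, refcubeo x -> f (F x) <= g (F x)) ->
  quad (@gx) (@gw) F n f <= quad (@gx) (@gw) F n g.
Proof.
move=> n0 fg; rewrite /quad; case: ifP => _.
  rewrite ler_wpM2l ?fine_ge0 ?measure_ge0//; apply: fg => i.
  by rewrite mxE oppr_lt0 ltr01.
have [_ gx1 gw0 _] := hgauss n0.
apply: ler_sum => k _; rewrite ler_wpM2l//.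
  by rewrite mulr_ge0// prodr_ge0// => i _; exact: ltW.
by apply: fg => i; rewrite mxE.
Qed.

(** The quadrature nodes lie in the open reference cube, where members of Qhp
    are polynomials and not merely defined almost everywhere. *)
Lemma quad_eq (F : E -> E) (n : nat) (f g : E -> R) : (0 < n)%N ->
  (forall x, refcubeo x -> f (F x) = g (F x)) ->
  quad (@gx) (@gw) F n f = quad (@gx) (@gw) F n g.
Proof.
by move=> n0 fg; apply: le_anti; rewrite !quad_le// => x xc; rewrite fg.
Qed.

Variables (kappa : R) (Omega : set E) (Th : finType).
Variables (F : Th -> E -> E) (p : Th -> nat) (sigma_y : R).
Hypotheses (d_gt0 : (0 < d)%N) (oOmega : open Omega).
Hypotheses (hmesh : hp_mesh kappa Omega F p) (sigma_y0 : 0 < sigma_y).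

Lemma psihpZ (c : R) (q : E -> M) :
  psihp (@gx) (@gw) F p sigma_y (c *: q) = `|c| * psihp (@gx) (@gw) F p sigma_y q.
Proof.
rewrite /psihp mulr_sumr; apply: eq_bigr => T _; rewrite -quadZ; congr quad.
apply/funext => x; change (sigma_y * fnorm (c *: q x) = `|c| * (sigma_y * fnorm (q x))).
by rewrite fnormZ mulrCA.
Qed.

(** The multiplier attaining the supremum represents the quadrature of the
    pairing with the unit direction of q. For non-affine elements in three
    dimensions the Gauss rule does not integrate the product of two members of
    Qhp exactly, so the nodal values of this multiplier need not have norm
    sigma_y: it is only obtained by duality. *)
Lemma psihp_attained (q : E -> M) : Qhp Omega F p q ->
  exists2 m, Lambdahp (@gx) (@gw) F p sigma_y Omega m &
    ip Omega m q = psihp (@gx) (@gw) F p sigma_y q.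
Proof.
move=> Qq; have p0 T : (0 < p T)%N by exact: (mesh_deg_ge1 hmesh).
pose pairing (r : E -> M) x := sigma_y * frob (direction (q x)) (r x).
pose G r := \sum_T quad (@gx) (@gw) (F T) (p T) (pairing r).
have node T x : refcubeo x -> mesh_interior F (F T x).
  by move=> xc; exists T => //; exists x.
have [c u v _ _|r Qr|r Qr r0|m Qm mG] := @Qhp_riesz R d kappa Omega Th F p oOmega hmesh G.
- rewrite /G mulr_sumr -big_split; apply: eq_bigr => T _.
  change (quad (@gx) (@gw) (F T) (p T) (pairing (c *: u + v)) =
    c * quad (@gx) (@gw) (F T) (p T) (pairing u) + quad (@gx) (@gw) (F T) (p T) (pairing v)).
  rewrite -quad_comb; congr quad; apply/funext => x; rewrite /pairing.
  change (sigma_y * frob (direction (q x)) (c *: u x + v x) =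
    c * (sigma_y * frob (direction (q x)) (u x)) + sigma_y * frob (direction (q x)) (v x)).
  by rewrite frobDr frobZr mulrDr mulrCA.
- apply: eq_bigr => T _; apply: quad_eq => // x xc.
  by rewrite /pairing glueT//; exact: node.
- rewrite /G big1// => T _.
  have -> : quad (@gx) (@gw) (F T) (p T) (pairing r) =
      quad (@gx) (@gw) (F T) (p T) (fun x => 0 * pairing r x).
    apply: quad_eq => // x xc; rewrite mul0r /pairing.
    have -> : r (F T x) = 0.
      apply/matrixP => i j; rewrite mxE; have [_ pr] := Qr.
      apply: (@polyQ_ae0 R d kappa Omega Th F p oOmega hmesh T _ (fun y => r y i j) (pr T i j)) => //.
      by apply: filterS r0 => y ry Oy; rewrite ry// mxE.
    by rewrite frobC frob0l mulr0.
  by rewrite quadZ mul0r.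
- exists m.
    split => // r Qr; rewrite mG//; apply: ler_sum => T _; apply: quad_le => // x xc.
    by rewrite ler_wpM2l ?(ltW sigma_y0)//; exact: frob_direction_le.
  rewrite mG//; apply: eq_bigr => T _; congr quad; apply/funext => x.
  by rewrite /pairing frob_direction.
Qed.

End quadrature.

Section bilinear_form.
Context (R : realType) (d : nat).
Local Notation E := 'rV[R]_d.
Local Notation M := 'M[R]_d.
Local Notation field := ((E -> E) * (E -> M))%type.
Variable Omega : set E.
Hypothesis oOmega : open Omega.

Let mOmega : measurable Omega.
Proof. exact: open_rV_measurable. Qed.

Lemma L2mx_strain (v : field) : H1 Omega v -> L2mx Omega (strain v).
Proof.
move=> [_ Lv _] i j; rewrite (_ : (fun _ => _) =
    (fun x => 2^-1 * (v.2 x i j + v.2 x j i))).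
  by apply: in_L2Z => //; exact: in_L2D.
by apply/funext => x; rewrite !mxE.
Qed.

Lemma strain_comb (c : R) (u v : field) :
  strain (c *: u + v) = c *: strain u + strain v.
Proof.
apply/funext => x; apply/matrixP => i j.
change ((2^-1 *: ((c *: u.2 x + v.2 x) + (c *: u.2 x + v.2 x)^T)) i j =
  (c *: (2^-1 *: (u.2 x + (u.2 x)^T)) + 2^-1 *: (v.2 x + (v.2 x)^T)) i j).
by rewrite !mxE; ring.
Qed.

Lemma L2mx_tapp (C : tensor4 R d) (S : set M) (c : R) (q : E -> M) :
  admissible_tensor Omega S c C -> L2mx Omega q -> L2mx Omega (tapp C q).
Proof.
move=> [CL _ _] Lq i j; rewrite (_ : (fun _ => _) =
    (fun x => \sum_k \sum_l C i j k l x * q x k l)); last first.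
  by apply/funext => x; rewrite mxE.
apply: in_L2_sum => // k; apply: in_L2_sum => // l.
by have [mC [b Cb]] := CL i j k l; exact: in_L2M_bounded mC Cb (Lq k l).
Qed.

Lemma L2mxB (A B : E -> M) : L2mx Omega A -> L2mx Omega B -> L2mx Omega (A - B).
Proof.
by move=> LA LB; rewrite -[A - B]addrC -scaleN1r; exact: L2mx_comb.
Qed.

Lemma L2mx_dev (A : E -> M) : L2mx Omega A -> L2mx Omega (fun x => dev (A x)).
Proof.
move=> LA i j; rewrite (_ : (fun _ => _) =
    (fun x => A x i j + (- (d%:R^-1 *+ (i == j))) * \sum_k A x k k)).
  by apply: in_L2D => //; apply: in_L2Z => //; exact: in_L2_sum.
apply/funext => x; rewrite /dev !mxE; congr (_ + _).
by rewrite mulNr mulrnAl mulrC.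
Qed.

Variables (C H : tensor4 R d) (S S' : set M) (c c' : R).
Hypotheses (hC : admissible_tensor Omega S c C).
Hypotheses (hH : admissible_tensor Omega S' c' H).

Lemma L2mx_sigma (u : field) (q : E -> M) : H1 Omega u -> L2mx Omega q ->
  L2mx Omega (sigma C u q).
Proof.
by move=> Hu Lq; apply: (L2mx_tapp hC); apply: L2mxB => //; exact: L2mx_strain.
Qed.

Definition dev_stress (u : field) (q : E -> M) : E -> M :=
  fun x => dev (sigma C u q x - tapp H q x).

Lemma L2mx_dev_stress (u : field) (q : E -> M) : H1 Omega u -> L2mx Omega q ->
  L2mx Omega (dev_stress u q).
Proof.
move=> Hu Lq; apply: (@L2mx_dev (sigma C u q - tapp H q)).
by apply: L2mxB; [exact: L2mx_sigma|exact: (L2mx_tapp hH)].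
Qed.

(** Displacements and plastic strains decouple: the two test functions enter
    through separate linear forms, the second one through the deviatoric
    stress. *)
Lemma aform_split (u v : field) (q r : E -> M) : H1 Omega u -> L2mx Omega q ->
  H1 Omega v -> Q Omega r ->
  aform Omega C H (u, q) (v, r) =
  ip Omega (sigma C u q) (strain v) - ip Omega (dev_stress u q) r.
Proof.
move=> Hu Lq Hv Qr; have Lr := Q_L2mx Qr.
have Ls := L2mx_sigma Hu Lq; have LH := L2mx_tapp hH Lq; have Lv := L2mx_strain Hv.
have -> : ip Omega (dev_stress u q) r = ip Omega (sigma C u q - tapp H q) r.
  apply: ip_ae_eq => //; [exact: L2mx_dev_stress|exact: L2mxB|].
  have [_ sr] := Qr; apply: filterS sr => x rx Ox.
  by rewrite /dev_stress frob_dev//; have [] := rx Ox.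
rewrite /aform /= -[strain v - r]addrC -[sigma C u q - tapp H q]addrC -(scaleN1r r) -(scaleN1r (tapp H q)).
rewrite (ip_linearr oOmega Ls)// (ip_linear oOmega Lr)//.
by ring.
Qed.

End bilinear_form.

(** * Equivalence of the two problems *)

Theorem theorem3 (R : realType) (d : nat) (hd : d = 2%N \/ d = 3%N)
    (Omega GammaD : set 'rV[R]_d)
    (hOmega : lipschitz_domain Omega)
    (hGammaD : GammaD `<=` boundary Omega)
    (C H : tensor4 R d) (c_e c_h : R) (hce : 0 < c_e) (hch : 0 < c_h)
    (hC : admissible_tensor Omega (@sym R d) c_e C)
    (hH : admissible_tensor Omega (@sym0 R d) c_h H)
    (sigma_y : R) (hsigma_y : 0 < sigma_y)
    (f : ('rV[R]_d -> 'rV[R]_d) * ('rV[R]_d -> 'M[R]_d) -> R)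
    (hf : in_Vdual Omega GammaD f)
    (g : ('rV[R]_d -> 'rV[R]_d) -> R)
    (hg : in_tracesN_dual Omega GammaD g)
    (kappa : R) (Th : finType) (F : Th -> 'rV[R]_d -> 'rV[R]_d)
    (p : Th -> nat) (hmesh : hp_mesh kappa Omega F p)
    (gx gw : forall n : nat, 'I_n -> R)
    (hgauss : forall n : nat, (0 < n)%N -> gauss_rule (gx n) (gw n)) :
  let a := aform Omega C H in
  let ell := load Omega GammaD f g in
  let Vh := Vhp Omega GammaD F p in
  let Qh := Qhp Omega F p in
  let psi := psihp gx gw F p sigma_y in
  let Lambda := Lambdahp gx gw F p sigma_y Omega in
  let solves_VI u q :=
    [/\ Vh u, Qh q &
        forall v r, Vh v -> Qh r ->
          a (u, q) (v - u, r - q) + psi r - psi q >= ell (v - u)] in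
  let solves_M u q lambda :=
    [/\ Vh u, Qh q, Lambda lambda,
        forall v r, Vh v -> Qh r ->
          a (u, q) (v, r) + ip Omega lambda r = ell v &
        forall mu, Lambda mu -> ip Omega (mu - lambda) q <= 0] in
  let multiplier u q :=
    Php Omega F p (fun x => dev (sigma C u q x - tapp H q x)) in
  (forall u q, solves_VI u q -> solves_M u q (multiplier u q)) /\
  (forall u q lambda, solves_M u q lambda ->
     solves_VI u q /\
     {ae leb R d, forall x, Omega x -> lambda x = multiplier u q x}).
Proof.
move=> a ell Vh Qh psi Lambda solves_VI solves_M multiplier.
have [_ oO _ bO _] := hOmega.
have d0 : (0 < d)%N by case: hd => ->.
have VhH1 v : Vh v -> H1 Omega v by move=> [[]].
have VhV v : Vh v -> V Omega GammaD v by case.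
have VhL c u v : Vh u -> Vh v -> Vh (c *: u + v) by exact: Vhp_comb.
have QhL c q r : Qh q -> Qh r -> Qh (c *: q + r) by exact: Qhp_comb.
have Qh0 : Qh 0 by exact: Qhp0.
have L2 q : Qh q -> L2mx Omega q by exact: Qhp_L2mx.
have subE (X : lmodType R) (x y : X) : x - y = (-1) *: y + x.
  by rewrite scaleN1r addrC.
have Vh0 v : Vh v -> Vh 0.
  by move=> Vv; have := VhL (-1) v v Vv Vv; rewrite scaleN1r addNr.
pose work u q v := ip Omega (sigma C u q) (strain v).
have workL u q : Vh u -> Qh q -> linear_on Vh (work u q).
  move=> Vu Qq c v w Vv Vw; rewrite /work strain_comb.
  apply: (ip_linearr oO).
  - by apply: (L2mx_sigma oO hC); [exact: VhH1|exact: L2].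
  - by apply: L2mx_strain => //; exact: VhH1.
  - by apply: L2mx_strain => //; exact: VhH1.
have ellL : linear_on Vh ell.
  by move=> c v w Vv Vw; apply: load_comb => //; exact: VhV.
have lin0 (f' : (_ * _)%type -> R) v : linear_on Vh f' -> Vh v -> f' 0 = 0.
  move=> lf Vv; have := lf (-1) v v Vv Vv.
  by rewrite scaleN1r addNr mulN1r addNr.
have multP u q : Vh u -> Qh q -> Qh (multiplier u q) /\
    forall v r, Vh v -> Qh r ->
      a (u, q) (v, r) = work u q v - ip Omega (multiplier u q) r.
  move=> Vu Qq; have Hu := VhH1 u Vu; have Lq := L2 q Qq.
  have [Qm mE] := Php_spec d0 oO hmesh (L2mx_dev_stress oO hC hH Hu Lq).
  split => // v r Vv Qr; rewrite [ip Omega (multiplier u q) r](mE r Qr).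
  by apply: (aform_split oO hC hH) => //; [exact: VhH1|case: Qr].
have ipL r : Qh r -> linear_on Qh ((ip Omega)^~ r).
  by move=> Qr c x y Qx Qy; apply: (ip_linear oO (L2 r Qr)); exact: L2.
have ipLr r : Qh r -> linear_on Qh (ip Omega r).
  by move=> Qr c x y Qx Qy; apply: (ip_linearr oO (L2 r Qr)); exact: L2.
split.
- move=> u q [Vu Qq VI]; have [Qm aE] := multP u q Vu Qq.
  set lambda := multiplier u q in Qm aE *.
  have VI' v r : Vh v -> Qh r -> ell (v - u) <=
      work u q (v - u) - (ip Omega lambda r - ip Omega lambda q) + psi r - psi q.
    move=> Vv Qr; have := VI v r Vv Qr; rewrite aE.
    + by rewrite [r - q]subE (ipLr _ Qm)// mulN1r [_ + ip _ _ r]addrC.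
    + by rewrite subE; exact: VhL.
    + by rewrite subE; exact: QhL.
  have equil v : Vh v -> work u q v = ell v.
    move=> Vv; apply: le_anti; apply/andP; split.
    + have Vw := VhL (-1) v u Vv Vu; have := VI' _ q Vw Qq.
      have -> : (-1) *: v + u - u = (-1) *: v + 0 by rewrite addrK addr0.
      have V0 := Vh0 v Vv.
      rewrite (workL u q Vu Qq)// ellL// (lin0 ell v)// (lin0 (work u q) v)//; last exact: workL.
      by lra.
    + have Vw := VhL 1 v u Vv Vu; have := VI' _ q Vw Qq.
      by rewrite scale1r addrK; lra.
  have flow r : Qh r -> ip Omega lambda r - ip Omega lambda q <= psi r - psi q.
    move=> Qr; have := VI' u r Vu Qr.
    rewrite subrr (lin0 ell u)// (lin0 (work u q) u)//; last exact: workL.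
    by lra.
  have psi0 : psi 0 = 0.
    by have := psihpZ gx gw F p sigma_y 0 0; rewrite scale0r normr0 mul0r.
  have ip0 : ip Omega lambda 0 = 0.
    by have := ipLr _ Qm (-1) 0 0 Qh0 Qh0; rewrite scaler0 addr0 mulN1r addNr.
  (* psi is positively homogeneous: the tests 0 and 2 q give both inequalities *)
  have ipq : ip Omega lambda q = psi q.
    have h0 := flow 0 Qh0.
    have Q2 : Qh (1 *: q + q) by exact: QhL.
    have h2 := flow _ Q2; rewrite (ipLr _ Qm)// in h2.
    have p2 : psi (1 *: q + q) = 2 * psi q.
      have := psihpZ gx gw F p sigma_y 2 q; rewrite ger0_norm//.
      by rewrite scaler_nat mulr2n scale1r.
    by move: h0 h2; rewrite psi0 ip0 p2; lra.
  split => //.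
  + split => // r Qr; have := flow r Qr; rewrite ipq.
    by rewrite lerD2r.
  + by move=> v r Vv Qr; rewrite aE// subrK equil.
  + move=> mu [Qmu mule]; rewrite subE (ipL _ Qq)// ipq mulN1r.
    by rewrite addrC subr_le0; exact: mule.
- move=> u q lambda [Vu Qq [Ql lle] M1 M2]; have [Qm aE] := multP u q Vu Qq.
  split; last first.
    have QD : Qh (lambda - multiplier u q) by rewrite subE; exact: QhL.
    have : ip Omega (lambda - multiplier u q) (lambda - multiplier u q) = 0.
      have V0 := Vh0 u Vu; have := M1 0 _ V0 QD.
      rewrite aE// (lin0 ell u)// (lin0 (work u q) u)//; last exact: workL.
      rewrite {3}[lambda - _]subE.
      set D := lambda - _ in QD *; rewrite (ipL _ QD)//; lra.
    move=> /(ip_definite oO (L2 _ QD)); apply: filterS => x H' Ox.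
    by apply/eqP; rewrite -subr_eq0; apply/eqP; exact: H'.
  split => // v r Vv Qr.
  have Vvu : Vh (v - u) by rewrite subE; exact: VhL.
  have Qrq : Qh (r - q) by rewrite subE; exact: QhL.
  rewrite -(M1 _ _ Vvu Qrq) [X in ip _ lambda X]subE (ipLr _ Ql)//.
  have [mu Lmu muq] := psihp_attained hgauss oO hmesh hsigma_y Qq.
  have := M2 mu Lmu; rewrite subE (ipL _ Qq)//; last by case: Lmu.
  rewrite muq; have := lle r Qr; rewrite -/psi; lra.
Qed.
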